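(* Let $t$ be a rational integer congruent to $7$ or $11$ modulo $25$, to $-2$ or $0$ modulo $125$, or to $989$ modulo $3125$. If the polynomial $$Y^4+5(t+2)(t^2+4)tY^2+5(t^2+4)(t+2)^2(t+1)^2t^2$$ is irreducible over $\mathbb{Q}$, then for $y$ a root of it, $\mathbb{Q}(y)$ is a cyclic extension of $\mathbb{Q}$; and if $$p(x)=(x+4)(x-1)^4+20(x-1)^2t+(10x^2-20x+26)t^2+(5x^2-10x+13)t^3+(-5x+6)t^4+2t^5$$ is likewise irreducible over $\mathbb{Q}$, then the splitting field of $p(x)$ over $\mathbb{Q}(y)$ is an unramified cyclic extension of $\mathbb{Q}(y)$.
   Context: A cyclic extension is a Galois extension with cyclic Galois group. *)

(* Defs.v *)
From HB Require Import structures.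
From mathcomp Require Import all_boot all_order all_algebra all_fingroup.
From mathcomp Require Import all_solvable all_field.

Set Implicit Arguments.
Unset Strict Implicit.
Unset Printing Implicit Defensive.

Import Order.TTheory GRing.Theory Num.Theory.
Local Open Scope ring_scope.

Definition quartic_poly (t : int) : {poly rat} :=
  let s : rat := t%:~R in
  'X^4 + (5 * (s + 2) * (s ^+ 2 + 4) * s) *: 'X^2
  + (5 * (s ^+ 2 + 4) * (s + 2) ^+ 2 * (s + 1) ^+ 2 * s ^+ 2)%:P.

Definition quintic_poly (t : int) : {poly rat} :=
  let s : {poly rat} := (t%:~R)%:P in
  ('X + 4) * ('X - 1) ^+ 4 + 20 * ('X - 1) ^+ 2 * s
  + (10 * 'X^2 - 20 * 'X + 26) * s ^+ 2
  + (5 * 'X^2 - 10 * 'X + 13) * s ^+ 3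
  + (- 5 * 'X + 6) * s ^+ 4
  + 2 * s ^+ 5.

Definition admissible (t : int) : Prop :=
  [\/ (t = 7 %[mod 25])%Z \/ (t = 11 %[mod 25])%Z,
      (t = - 2 %[mod 125])%Z \/ (t = 0 %[mod 125])%Z
    | (t = 989 %[mod 3125])%Z].

Section Ideals.

Variables (R : comNzRingType) (A : R -> Prop).

(* A is meant to be a subring of R; ideals of A are subsets of R. *)
Definition is_ideal (I : R -> Prop) : Prop :=
  [/\ forall x, I x -> A x,
      I 0,
      forall x y, I x -> I y -> I (x + y)
    & forall a x, A a -> I x -> I (a * x)].

Definition is_prime_ideal (I : R -> Prop) : Prop :=
  [/\ is_ideal I, ~ I 1
    & forall x y, A x -> A y -> I (x * y) -> I x \/ I y].

Definition ideal_mul (I J : R -> Prop) (x : R) : Prop :=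
  exists n (u v : 'I_n -> R),
    [/\ forall i, I (u i), forall i, J (v i) & x = \sum_i u i * v i].

Fixpoint ideal_exp (I : R -> Prop) (n : nat) : R -> Prop :=
  if n is n'.+1 then ideal_mul I (ideal_exp I n') else A.

(* Extension of S to A, that is, the ideal S A. *)
Definition ideal_ext (S : R -> Prop) : R -> Prop := ideal_mul S A.

End Ideals.

Section NumberFields.

(* A number field is represented as a subfield of an ambient finite normal
   extension L of Q. *)
Variable L : splittingFieldType rat.
Implicit Types K E : {subfield L}.

Definition cyclic_extension K E : Prop := galois K E /\ cyclic 'Gal(E / K).

Definition ring_of_integers E (x : L) : Prop :=
  x \in E /\ integralOver (intr : int -> L) x.

Definition nonzero_prime E (P : L -> Prop) : Prop :=
  is_prime_ideal (ring_of_integers E) P /\ exists2 x, P x & x != 0.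

Definition lies_over K (P Q : L -> Prop) : Prop :=
  forall x, P x <-> x \in K /\ Q x.

(* e is the exponent of Q in the factorization of P O_E: the powers of Q that
   contain P O_E are exactly the Q^k with k <= e. *)
Definition ramification_index E (P Q : L -> Prop) (e : nat) : Prop :=
  let OE := ring_of_integers E in
  forall k, (forall x, ideal_ext OE P x -> ideal_exp OE Q k x) <-> (k <= e)%N.

(* Residue fields are finite, so separability of residue extensions is
   automatic. *)
Definition unramified_at_primes K E : Prop :=
  forall P Q : L -> Prop,
    nonzero_prime K P -> nonzero_prime E Q -> lies_over K P Q ->
    ramification_index E P Q 1.

(* Every embedding of E into the complex numbers takes values in algC and
   extends to L, so the places of E at infinity all come from maps L -> algC.
   The condition says that no real place of K lies below a complex one of E. *)
Definition unramified_at_infinity K E : Prop :=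
  forall f : {rmorphism L -> algC},
    (forall x, x \in K -> f x \is Num.real) ->
    forall x, x \in E -> f x \is Num.real.

Definition unramified K E : Prop :=
  [/\ (K <= E)%VS, unramified_at_primes K E & unramified_at_infinity K E].

End NumberFields.

(* Main.v *)
(* K = Q(y) contains w with w^2 = 5(t^2+4) and y^2 = t(t+2)w(t-4-w)/2, and
   y -> (t+1)(t+2)tw/y sends w to -w and has order 4; since t(t+2) > 0, K is
   totally imaginary, so nothing can ramify at infinity.  If x is a root of p,
   the quartic p(X)/(X-x) is a product of two quadratics over Q(w, x) whose
   discriminants are squares in K(x), so E = K(x) has degree 5 over K.

   As [E : K] = 5 is prime, a prime of E ramified over K is fixed by Gal(E/K)
   with every automorphism acting trivially modulo it, so that the minimal
   polynomial over K of an integral z is congruent to (X-z)^5.  Away from 5 this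
   is excluded by the coefficients of p.  Above 5 it makes the trace of z
   divisible by 5; the congruences on t are what provides a generator z of Q(x),
   either (x-a)/5 or b/(x-a), which is integral with rational trace prime to 5. *)
Require Import Defs.
From HB Require Import structures.
From mathcomp Require Import all_boot all_order all_algebra all_fingroup.
From mathcomp Require Import all_solvable all_field.
From mathcomp Require Import ring zify.
From Stdlib Require Import Classical.

Import Order.TTheory GRing.Theory Num.Theory.
Local Open Scope ring_scope.

Set Implicit Arguments.
Unset Strict Implicit.
Unset Printing Implicit Defensive.

(** * Integers of a number field *)

Section IntegersOfNumberField.

Variable L : splittingFieldType rat.
Implicit Types (K E : {subfield L}) (x y z : L).

Notation OO := ring_of_integers.

(** Ramification is defined by containment of ideals, and the passage from inertia to ramification
    is made without factoring ideals. Suppose that each s <> 1 in Gal(E/K) moves some integral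
    element modulo the prime Q. Then there are integral a_i, b_i such that sum a_i s(b_i) is 0 for s
    <> 1 and some d outside Q for s = 1, so that d x = sum a_i Tr(b_i x). If x in Q is first
    multiplied by a suitable c outside Q, the traces fall into P. Were P O_E contained in Q^2, this
    would put d c Q inside Q^2, and the determinant trick would put d c in Q, which is absurd. All
    that is needed of Q is finite generation as an abelian group, and the trace form provides it.

    The quintics are all taken with rational integer coefficients. Since 4 and 5 are coprime, a
    generator of Q(x) over the rationals also generates E over K and keeps its minimal
    polynomial. *)

Lemma intr_ext_eq0 (k : int) : (k%:~R == 0 :> L) = (k == 0).
Proof.
have -> : k%:~R = in_alg L k%:~R by rewrite rmorph_int.
by rewrite fmorph_eq0 intr_eq0.
Qed.

Lemma intr_ext_inj : injective (intr : int -> L).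
Proof.
by move=> j k /eqP; rewrite -subr_eq0 -rmorphB intr_ext_eq0 subr_eq0 => /eqP.
Qed.

Lemma integral_int (k : int) : integralOver (intr : int -> L) k%:~R.
Proof. exact: integral_id. Qed.

Lemma intr_OO E (k : int) : OO E k%:~R.
Proof. by split; [apply: rpred_int | apply: integral_int]. Qed.

Lemma OO0 E : OO E 0. Proof. exact: (intr_OO E 0). Qed.
Lemma OO1 E : OO E 1. Proof. exact: (intr_OO E 1). Qed.

Lemma OO_add E x y : OO E x -> OO E y -> OO E (x + y).
Proof.
by case=> Ex Ix [Ey Iy]; split; [rewrite rpredD | apply: integral_add].
Qed.

Lemma OO_opp E x : OO E x -> OO E (- x).
Proof. by case=> Ex Ix; split; [rewrite rpredN | apply: integral_opp]. Qed.

Lemma OO_sub E x y : OO E x -> OO E y -> OO E (x - y).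
Proof. by move=> Ox /OO_opp; apply: OO_add. Qed.

Lemma OO_mul E x y : OO E x -> OO E y -> OO E (x * y).
Proof.
by case=> Ex Ix [Ey Iy]; split; [rewrite rpredM | apply: integral_mul].
Qed.

Lemma OO_exp E x n : OO E x -> OO E (x ^+ n).
Proof.
by move=> Ox; elim: n => [|n IH]; rewrite ?expr0 ?exprS; [apply: OO1 | apply: OO_mul].
Qed.

Lemma OO_sum E (I : Type) (r : seq I) (P : pred I) (F : I -> L) :
  (forall i, P i -> OO E (F i)) -> OO E (\sum_(i <- r | P i) F i).
Proof.
by move=> OF; elim/big_ind: _ => //; [apply: OO0 | move=> x y; apply: OO_add].
Qed.

Lemma OO_prod E (I : Type) (r : seq I) (P : pred I) (F : I -> L) :
  (forall i, P i -> OO E (F i)) -> OO E (\prod_(i <- r | P i) F i).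
Proof.
by move=> OF; elim/big_ind: _ => //; [apply: OO1 | move=> x y; apply: OO_mul].
Qed.

Lemma OO_gal E (s : gal_of E) x : OO E x -> OO E (s x).
Proof.
case=> Ex [p mon_p px0]; split; first by rewrite memv_gal.
exists p => //; have -> : map_poly intr p = map_poly s (map_poly intr p).
  rewrite -map_poly_comp; apply: eq_map_poly => k. by rewrite /= rmorph_int.
by rewrite fmorph_root.
Qed.

Lemma rat_integral_int x : x \in 1%VS -> integralOver (intr : int -> L) x ->
  exists k : int, x = k%:~R.
Proof.
case/vlineP=> a ->; rewrite /= => -[p mon_p].
have -> : a%:A = in_alg L a by rewrite in_algE.
have -> : map_poly (intr : int -> L) p
          = map_poly (in_alg L) (map_poly intr p).
  by rewrite -map_poly_comp; apply: eq_map_poly => k /=; rewrite scaler_int.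
rewrite fmorph_root => pa0.
have : (ratr a : algC) \is a Num.int.
  apply: Cint_rat_Aint; first by apply/CratP; exists a.
  apply: (@root_monic_Aint (map_poly intr p)); last 2 first.
  - by rewrite monic_map.
  - by apply/polyOverP=> i; rewrite coef_map /= intr_int.
  have -> : map_poly (intr : int -> algC) p = map_poly ratr (map_poly intr p).
    by rewrite -map_poly_comp; apply: eq_map_poly => k /=; rewrite ratr_int.
  by rewrite fmorph_root.
case/intrP=> k; rewrite -[in RHS](ratr_int algC) => /fmorph_inj ->.
by exists k; rewrite /= scaler_int.
Qed.


Lemma integral_multiple x :
  exists2 N : int, N != 0 & integralOver (intr : int -> L) (N%:~R * x).
Proof.
have /polyOver1P[q0 Dq0] := minPolyOver 1 x.
have [q [a nz_a Dq]] := rat_poly_scale q0.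
have nz_q0 : q0 != 0.
  by rewrite -(map_poly_eq0 (in_alg L)) -Dq0 monic_neq0 ?monic_minPoly.
have nz_q : q != 0 by apply: contraNneq nz_q0 => q0_; rewrite Dq q0_ rmorph0 scaler0.
have qx0 : (map_poly intr q).[x] = 0.
  have : root (minPoly 1 x) x := root_minPoly 1 x.
  rewrite Dq0 Dq linearZ /= rootZ; last first.
    by rewrite scaler_eq0 oner_eq0 orbF invr_eq0 intr_eq0.
  rewrite -map_poly_comp => /rootP <-; congr _.[_].
  by apply: eq_map_poly => k /=; rewrite scaler_int.
pose n := (size q).-1; pose c := lead_coef q.
have size_q : size q = n.+1 by rewrite prednK // lt0n size_poly_eq0.
have n_gt0 : (0 < n)%N.
  rewrite lt0n; apply: contraTneq (nz_q) => n0; move: qx0.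
  have /size_poly1P[b nz_b ->] : size q == 1%N by rewrite size_q n0.
  by rewrite map_polyC hornerC /= => /eqP; rewrite intr_ext_eq0 (negPf nz_b).
exists c; first by rewrite lead_coef_eq0.
(* [r] is the monic integral polynomial with r(c X) = c^(n-1) q(X). *)
pose r := 'X^n + \poly_(i < n) (c ^+ (n.-1 - i) * q`_i).
exists r.
  by rewrite monicE lead_coefDl ?lead_coefXn // size_polyXn ltnS size_poly.
apply/rootP; rewrite rmorphD /= map_polyXn hornerD hornerXn exprMn.
rewrite (@horner_coef_wide _ n (map_poly _ _)); last first.
  by rewrite (leq_trans (size_poly _ _)) ?size_poly.
have -> : c%:~R ^+ n = c%:~R ^+ n.-1 * (q`_n)%:~R :> L.
  by rewrite -exprSr prednK // /c lead_coefE.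
rewrite (eq_bigr (fun i : 'I_n => c%:~R ^+ n.-1 * ((q`_i)%:~R * x ^+ i))).
  rewrite -mulr_sumr -mulrA -mulrDr.
  have <- : (map_poly intr q).[x] = (q`_n)%:~R * x ^+ n + \sum_(i < n) (q`_i)%:~R * x ^+ i.
    rewrite (@horner_coef_wide _ n.+1).
      rewrite big_ord_recr /= addrC coef_map; congr (_ + _).
      by apply: eq_bigr => i _; rewrite coef_map.
    by rewrite size_map_inj_poly ?size_q //; apply: intr_ext_inj.
  by rewrite qx0 mulr0.
move=> i _; rewrite coef_map coef_poly ltn_ord /= rmorphM /= rmorphXn /= exprMn.
have {2}-> : n.-1 = (n.-1 - i + i)%N by have := ltn_ord i; lia.
by rewrite exprD; ring.
Qed.


Lemma least_nat (P : nat -> Prop) :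
  (exists n, P n) -> exists2 n, P n & forall m, P m -> (n <= m)%N.
Proof.
move=> [n Pn]; apply: NNPP => no_min.
suff noP m : forall k, (k <= m)%N -> ~ P k by exact: (noP n n).
elim: m => [|m IH] k; first by rewrite leqn0 => /eqP-> P0; apply: no_min; exists 0%N.
rewrite leq_eqVlt => /predU1P[-> Pm | /IH//]; apply: no_min; exists m.+1 => // j Pj.
by rewrite ltnNge; apply/negP=> /IH.
Qed.

(** Induction on the number of integer-valued additive forms. The kernel of the last form is
    generated by induction; if that form is not zero on [I], an element where it takes its least
    positive value generates the rest by Euclidean division. Entries past the end of [gs] are 0,
    which lies in [I], so the index needs no bound. *)
Lemma forms_fg (n : nat) (f : nat -> L -> L) (I : L -> Prop) :
    (forall i, {morph f i : x y / x - y}) ->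
    I 0 -> (forall x y, I x -> I y -> I (x - y)) ->
    (forall i x, (i < n)%N -> I x -> exists k : int, f i x = k%:~R) ->
    (forall x, I x -> (forall i, (i < n)%N -> f i x = 0) -> x = 0) ->
  exists gs : seq L, (forall i, I gs`_i) /\
    forall x, I x -> exists c : nat -> int,
      x = \sum_(i < size gs) (c i)%:~R * gs`_i.
Proof.
move=> fB; elim: n I => [|n IH] I I0 IB fint finj.
  exists [::]; split=> [i|x Ix]; first by rewrite nth_nil.
  by exists (fun _ => 0); rewrite big_ord0; apply: finj.
have f0 i : f i 0 = 0 by rewrite -{1}(subrr 0) fB subrr.
have IN x : I x -> I (- x) by rewrite -[- x]add0r; apply: IB.
have fN i x : f i (- x) = - f i x by rewrite -[- x]add0r fB f0 add0r.
have Imul (k : int) x : I x -> I (k%:~R * x) /\ f n (k%:~R * x) = k%:~R * f n x.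
  move=> Ix; case: (intP k) => [|m|m]; first by rewrite !mul0r f0.
    elim: m => [|m [IHm1 IHm2]]; first by rewrite !mul1r.
    rewrite -addn1 PoszD !rmorphD /= !mulrDl !mul1r.
    have -> : m.+1%:~R * x + x = m.+1%:~R * x - - x by rewrite opprK.
    by split; [apply/IB/IN | rewrite fB IHm2 fN opprK].
  elim: m => [|m [IHm1 IHm2]]; first by rewrite !mulN1r fN; split=> //; apply: IN.
  rewrite -addn1 PoszD opprD !rmorphB /= !mulrBl !mul1r.
  by split; [apply: IB | rewrite fB IHm2].
pose J x := I x /\ f n x = 0.
have [gs [Jgs genJ]] : exists gs : seq L, (forall i, J gs`_i) /\
    forall x, J x -> exists c : nat -> int,
      x = \sum_(i < size gs) (c i)%:~R * gs`_i.
  apply: IH => [|x y [Ix fx] [Iy fy]|i x lt_in [Ix _]|x [Ix fx] f0x].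
  - by split.
  - by split; [apply: IB | rewrite fB fx fy subrr].
  - by apply: fint Ix; apply: ltnW.
  - by apply: finj => // i; rewrite ltnS leq_eqVlt => /predU1P[-> // | /f0x].
pose P m := (0 < m)%N /\ exists2 g, I g & f n g = m%:R.
have [exP | noP] := classic (exists m, P m); last first.
  exists gs; split=> [i|x Ix]; first by case: (Jgs i).
  apply: genJ; split=> //; have [k fxk] := fint n x (ltnSn n) Ix.
  apply: NNPP => nz_fx; apply: noP; case: (intP k) fxk => [|m|m] fxk.
  - by case: nz_fx; rewrite fxk.
  - by exists m.+1; split=> //; exists x.
  - by exists m.+1; split=> //; exists (- x); rewrite ?fN ?fxk ?rmorphN ?opprK //; apply: IN.
have [m [m_gt0 [g Ig fg]] min_m] := least_nat exP.
exists (g :: gs); split=> [[|i] //=|x Ix]; first by case: (Jgs i).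
have [k fxk] := fint n x (ltnSn n) Ix; pose q := (k %/ m)%Z.
have [Iqg fqg] := Imul q g Ig.
have /genJ[c Dx]: J (x - q%:~R * g).
  split; first exact: IB.
  rewrite fB fqg fg fxk; have Dk : k = q * m%:Z + (k %% m)%Z by exact: divz_eq.
  have := ltz_pmod k (m_gt0 : 0 < m%:Z); have : 0 <= (k %% m)%Z.
    by rewrite modz_ge0 // -lt0n.
  move: Dk; case: (k %% m)%Z => // r Dk _ lt_rm.
  rewrite {1}Dk rmorphD rmorphM /= addrAC subrr add0r.
  case: r Dk lt_rm => // r Dk; rewrite ltz_nat ltnNge => /negP[]; apply: min_m.
  split=> //; exists (x - q%:~R * g); first exact: IB.
  by rewrite fB fqg fg fxk Dk rmorphD rmorphM /= addrAC subrr add0r.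
exists (fun i => if i is i'.+1 then c i' else q).
by rewrite big_ord_recl /= -Dx addrC subrK.
Qed.

Lemma galois1 : galois 1%AS {:L}%AS.
Proof.
apply/and3P; split; [exact: sub1v | | exact: normalFieldf].
apply/separableP => x _; apply: pcharf0_separable => p.
by rewrite (pchar_lalg L) pchar_num.
Qed.

Lemma galTraceZ (K E : {subfield L}) (a : rat) x :
  galTrace K E (a *: x) = a *: galTrace K E x.
Proof. by rewrite /galTrace scaler_sumr; apply: eq_bigr => s _; rewrite linearZ. Qed.

(** The forms are x -> Tr(N_i v_i x), where v_i is a basis of L and the N_i v_i are integral; their
    values are rational and integral, hence integers. If all of them vanish at x <> 0, then so does
    Tr(x^-1 x), the order of the Galois group. The trace is taken from L, which is Galois over the
    rationals, as its subfields need not be. *)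
Lemma integral_fg (I : L -> Prop) :
    (forall x, I x -> integralOver (intr : int -> L) x) ->
    I 0 -> (forall x y, I x -> I y -> I (x - y)) ->
  exists gs : seq L, (forall i, I gs`_i) /\
    forall x, I x -> exists c : nat -> int,
      x = \sum_(i < size gs) (c i)%:~R * gs`_i.
Proof.
move=> Iint I0 IB; pose v := vbasis {:L}.
have [N NP] : exists N : 'I_(\dim {:L}) -> int, forall i,
    N i != 0 /\ integralOver (intr : int -> L) ((N i)%:~R * v`_i).
  apply: (@fin_all_exists 'I_(\dim {:L}) (fun _ => int)
    (fun i N => N != 0 /\ integralOver intr (N%:~R * v`_i))).
  by move=> i; have [N nzN] := integral_multiple v`_i; exists N.
pose e i := if insub i is Some j then (N j)%:~R * v`_j else 0.
pose f i x := galTrace 1 {:L} (e i * x).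
have TrZ (k : int) x : galTrace 1 {:L} (k%:~R * x) = k%:~R * galTrace 1 {:L} x.
  by rewrite !mulrzl raddfMz.
apply: (@forms_fg (\dim {:L}) f) => // [i x y|i x lt_in Ix|x Ix f0].
- by rewrite /f mulrBr raddfB.
- rewrite /f /e insubT; apply: rat_integral_int.
    exact: (mem_galTrace galois1 (memvf _)).
  have [_ Oe] := NP (Sub i lt_in).
  have: ring_of_integers {:L}%AS ((N (Sub i lt_in))%:~R * v`_i * x).
    by split; [apply: memvf | apply: integral_mul; [|apply: Iint]].
  move=> Oy; suff [] : ring_of_integers {:L}%AS
    (galTrace 1 {:L} ((N (Sub i lt_in))%:~R * v`_i * x)) by [].
  by apply: OO_sum => s _; apply: OO_gal.
apply/eqP/negPn/negP => nz_x.
have Tr0 y : galTrace 1 {:L} (y * x) = 0.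
  rewrite (coord_vbasis (memvf y)) mulr_suml raddf_sum big1 //= => i _.
  rewrite -scalerAl galTraceZ; have /eqP := f0 i (ltn_ord i).
  rewrite /f /e valK -mulrA TrZ mulf_eq0 intr_ext_eq0.
  by case: (NP i) => /negPf-> _ /eqP->; rewrite scaler0.
have /eqP := Tr0 x^-1; rewrite mulVf // /galTrace.
under eq_bigr do rewrite rmorph1.
rewrite sumr_const (_ : 1 *+ _ = (#|'Gal({:L} / 1)%g|%:Z)%:~R) // intr_ext_eq0.
by have := cardG_gt0 'Gal({:L} / 1); case: #|_|.
Qed.

End IntegersOfNumberField.

(** * Trivial inertia and the ramification index *)

Section Ramification.

Variables (L : splittingFieldType rat) (E : {subfield L}) (Q : L -> Prop).
Hypothesis prQ : nonzero_prime E Q.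

Let OE := ring_of_integers E.

Lemma prime_OO x : Q x -> OE x.
Proof. by case: prQ => [[[QO _ _ _] _ _] _]; apply: QO. Qed.

Lemma prime0 : Q 0.
Proof. by case: prQ => [[[]]]. Qed.

Lemma prime1 : ~ Q 1.
Proof. by case: prQ => [[]]. Qed.

Lemma prime_add x y : Q x -> Q y -> Q (x + y).
Proof. by case: prQ => [[[_ _ QD _] _ _] _]; apply: QD. Qed.

Lemma prime_mull a x : OE a -> Q x -> Q (a * x).
Proof. by case: prQ => [[[_ _ _ QM] _ _] _]; apply: QM. Qed.

Lemma prime_mulr a x : OE a -> Q x -> Q (x * a).
Proof. by rewrite mulrC; apply: prime_mull. Qed.

Lemma prime_opp x : Q x -> Q (- x).
Proof.
by move=> Qx; rewrite -mulN1r; apply: prime_mull => //; apply/OO_opp/OO1.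
Qed.

Lemma prime_sub x y : Q x -> Q y -> Q (x - y).
Proof. by move=> Qx /prime_opp; apply: prime_add. Qed.

Lemma prime_or x y : OE x -> OE y -> Q (x * y) -> Q x \/ Q y.
Proof. by case: prQ => [[_ _ QP] _]; apply: QP. Qed.

Lemma prime_exp x n : OE x -> Q (x ^+ n) -> Q x.
Proof.
move=> Ox; elim: n => [/prime1//|n IH]; rewrite exprS.
by case/(prime_or Ox (OO_exp n Ox)) => // /IH.
Qed.

Lemma prime_sum (I : Type) (r : seq I) (P : pred I) (F : I -> L) :
  (forall i, P i -> Q (F i)) -> Q (\sum_(i <- r | P i) F i).
Proof.
by move=> QF; elim/big_ind: _ => //; [apply: prime0 | move=> x y; apply: prime_add].
Qed.

Lemma prime_prod_notin (I : Type) (r : seq I) (P : pred I) (F : I -> L) :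
    (forall i, P i -> OE (F i)) -> (forall i, P i -> ~ Q (F i)) ->
  ~ Q (\prod_(i <- r | P i) F i).
Proof.
move=> OF QF; suff [] : OE (\prod_(i <- r | P i) F i) /\
  ~ Q (\prod_(i <- r | P i) F i) by [].
elim/big_ind: _ => [|x y [Ox Qx] [Oy Qy]|i Pi].
- by split; [apply: OO1 | apply: prime1].
- by split; [apply: OO_mul | case/prime_or].
- by split; [apply: OF | apply: QF].
Qed.

(** Integrality of both sides is part of the relation, so that congruences can be multiplied. *)
Definition prime_congr x y := [/\ OE x, OE y & Q (x - y)].

Lemma congr_refl x : OE x -> prime_congr x x.
Proof. by split=> //; rewrite subrr; apply: prime0. Qed.

Lemma congr_add x1 y1 x2 y2 :
  prime_congr x1 y1 -> prime_congr x2 y2 -> prime_congr (x1 + x2) (y1 + y2).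
Proof.
move=> [Ox1 Oy1 Q1] [Ox2 Oy2 Q2]; split; try exact: OO_add.
by rewrite opprD addrACA; apply: prime_add.
Qed.

Lemma congr_mul x1 y1 x2 y2 :
  prime_congr x1 y1 -> prime_congr x2 y2 -> prime_congr (x1 * x2) (y1 * y2).
Proof.
move=> [Ox1 Oy1 Q1] [Ox2 Oy2 Q2]; split; try exact: OO_mul.
have -> : x1 * x2 - y1 * y2 = (x1 - y1) * x2 + y1 * (x2 - y2) by ring.
by apply: prime_add; [apply: prime_mulr | apply: prime_mull].
Qed.

Lemma congr_sum (I : Type) (r : seq I) (F G : I -> L) :
  (forall i, prime_congr (F i) (G i)) ->
  prime_congr (\sum_(i <- r) F i) (\sum_(i <- r) G i).
Proof.
move=> FG; elim/big_ind2: _ => // [|x1 x2 y1 y2]; last exact: congr_add.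
exact/congr_refl/OO0.
Qed.

Lemma congr_prod (I : Type) (r : seq I) (F G : I -> L) :
  (forall i, prime_congr (F i) (G i)) ->
  prime_congr (\prod_(i <- r) F i) (\prod_(i <- r) G i).
Proof.
move=> FG; elim/big_ind2: _ => // [|x1 x2 y1 y2]; last exact: congr_mul.
exact/congr_refl/OO1.
Qed.

Lemma congr_det n (A B : 'M[L]_n) :
  (forall i j, prime_congr (A i j) (B i j)) -> prime_congr (\det A) (\det B).
Proof.
move=> AB; apply: congr_sum => s; apply: congr_mul; last exact: congr_prod.
apply: congr_refl; case: odd_perm; last exact: OO1.
by rewrite expr1; apply/OO_opp/OO1.
Qed.

(* Nakayama's lemma, by the determinant trick. *)
Lemma prime_of_mul_sub e :
  OE e -> (forall x, Q x -> ideal_mul Q Q (e * x)) -> Q e.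
Proof.
move=> Oe eQ; have [||x y|gs [Qg genQ]] := @integral_fg L Q.
- by move=> x /prime_OO[].
- exact: prime0.
- exact: prime_sub.
set n := size gs in genQ.
have [q qP] : exists q : 'I_n -> 'I_n -> L, forall i,
    (forall j, Q (q i j)) /\ e * gs`_i = \sum_j q i j * gs`_j.
  apply: (@fin_all_exists 'I_n (fun _ => 'I_n -> L)
    (fun i qi => (forall j, Q (qi j)) /\ e * gs`_i = \sum_j qi j * gs`_j)) => i.
  have [m [u [v [Qu Qv ->]]]] := eQ _ (Qg i).
  have [c Dv] : exists c : 'I_m -> nat -> int, forall k,
      v k = \sum_(j < n) (c k j)%:~R * gs`_j.
    apply: (@fin_all_exists 'I_m (fun _ => nat -> int)
      (fun k c => v k = \sum_(j < n) (c j)%:~R * gs`_j)) => k.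
    exact: genQ.
  exists (fun j => \sum_k u k * (c k j)%:~R); split=> [j|].
    by apply: prime_sum => k _; apply: prime_mulr => //; apply: intr_OO.
  under [RHS]eq_bigr do rewrite mulr_suml.
  rewrite exchange_big /=; apply: eq_bigr => k _; rewrite Dv mulr_sumr.
  by apply: eq_bigr => j _; rewrite mulrA.
(* The entries of [M] lie in Q, so det A is congruent to e^n. It vanishes because [A] kills the
   column of generators, which are not all 0. *)
pose M := \matrix_(i, j) q i j; pose A := e%:M - M.
have Qdet : Q (\det A).
  suff A_g0 : A *m (\col_i gs`_i) = 0.
    have [uA|] := boolP (A \in unitmx).
      have g0 i : gs`_i = 0.
        have [lt_in | le_ni] := ltnP i n; last by rewrite nth_default.
        have /(congr1 (fun c : 'cV_n => c (Ordinal lt_in) 0)) := mulKmx uA (\col_i gs`_i).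
        by rewrite A_g0 mulmx0 !mxE.
      case: prQ => _ [x Qx /eqP[]]; have [c ->] := genQ x Qx.
      by rewrite big1 // => i _; rewrite g0 mulr0.
    by rewrite unitmxE unitfE negbK => /eqP->; apply: prime0.
  apply/colP=> i; rewrite mulmxBl mul_scalar_mx !mxE.
  have [_ ->] := qP i; apply/eqP; rewrite subr_eq0; apply/eqP.
  by apply: eq_bigr => j _; rewrite !mxE.
apply: (@prime_exp _ n) => //.
have [|_ _] := @congr_det n A e%:M; last first.
  rewrite det_scalar => Qd; rewrite -[e ^+ n](subKr (\det A)).
  exact: prime_sub.
move=> i j; have Oeij : OE (e%:M i j).
  by rewrite mxE; case: (_ == _); rewrite ?mulr1n ?mulr0n //; apply: OO0.
have [Qq _] := qP i; rewrite !mxE in Oeij *.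
split=> //; first by apply: OO_sub => //; apply: prime_OO.
by rewrite addrAC subrr add0r; apply: prime_opp.
Qed.

Variables (K : {subfield L}) (galKE : galois K E).

Let sKE : (K <= E)%VS. Proof. by case/and3P: galKE. Qed.

Let G := 'Gal(E / K)%g.

(** For a single s, either some c outside Q has s(c) in Q, or s^-1 Q is contained in Q. In the
    second case the finite order of s gives s Q = Q, and c = 1 works. The product of these c over
    the group stays outside the prime Q. *)
Lemma exists_avoiding_conj : exists c, [/\ OE c, ~ Q c &
  forall x s, s \in G -> Q x -> Q (s (c * x))].
Proof.
have avoid (s : gal_of E) : s \in G ->
    exists c, [/\ OE c, ~ Q c & forall x, Q x -> Q (s (c * x))].
  move=> Gs; have [[c [Oc Qc Qsc]] | no_c] :=
    classic (exists c, [/\ OE c, ~ Q c & Q (s c)]).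
    exists c; split=> // x Qx; rewrite rmorphM; apply: prime_mulr => //.
    exact/OO_gal/prime_OO.
  have Q_of_s c : OE c -> Q (s c) -> Q c.
    by move=> Oc Qsc; apply: NNPP => Qc; apply: no_c; exists c.
  exists 1; split=> [||x Qx]; [exact: OO1 | exact: prime1 | rewrite mul1r].
  have QsX n y : OE y -> Q ((s ^+ n)%g y) -> Q y.
    elim: n y => [|n IH] y Oy; first by rewrite expg0 gal_id.
    rewrite expgS galM; last by case: Oy.
    by move/IH => /(_ (OO_gal s Oy)); apply: Q_of_s.
  have Ox := prime_OO Qx; apply: (QsX #[s]%g.-1); first exact: OO_gal.
  by rewrite -galM -?expgS ?prednK ?order_gt0 ?expg_order ?gal_id //; case: Ox.
have [c cP] : exists c : gal_of E -> L, forall s, s \in G ->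
    [/\ OE (c s), ~ Q (c s) & forall x, Q x -> Q (s (c s * x))].
  apply: (@fin_all_exists (gal_of E) (fun _ => L) (fun s c => s \in G ->
    [/\ OE c, ~ Q c & forall x, Q x -> Q (s (c * x))])) => s.
  by have [/avoid[c ?]|?] := boolP (s \in G); [exists c | exists 0].
exists (\prod_(s in G) c s); split=> [||x s Gs Qx].
- by apply: OO_prod => s /cP[].
- by apply: prime_prod_notin => s /cP[].
rewrite (bigD1 s) //= mulrAC rmorphM; apply: prime_mulr.
  by apply/OO_gal/OO_prod => s' /andP[/cP[]].
by have [_ _] := cP s Gs; apply.
Qed.

(* The list r represents the tensor prod_s (s z_s (x) 1 - 1 (x) z_s). *)
Lemma exists_separating_tensor (z : gal_of E -> L) (ss : seq (gal_of E)) :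
    (forall s, s \in ss -> OE (z s)) ->
  exists r : seq (L * L), (forall p, p \in r -> OE p.1 /\ OE p.2) /\
    forall s : gal_of E, \sum_(p <- r) p.1 * s p.2
      = \prod_(s' <- ss) (s' (z s') - s (z s')).
Proof.
elim: ss => [|s0 ss IH] Oz.
  exists [:: (1, 1)]; split=> [p|s]; last by rewrite big_seq1 big_nil /= rmorph1 mul1r.
  by rewrite inE => /eqP->; split; apply: OO1.
have [|r [Or Dr]] := IH; first by move=> s ss_s; apply: Oz; rewrite inE ss_s orbT.
have Oz0 : OE (z s0) by apply: Oz; rewrite mem_head.
exists ([seq (s0 (z s0) * p.1, p.2) | p <- r] ++ [seq (- p.1, z s0 * p.2) | p <- r]).
split=> [p|s].
  rewrite mem_cat => /orP[] /mapP[q /Or[Oq1 Oq2] ->] /=; split=> //.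
  - by apply: OO_mul => //; apply: OO_gal.
  - exact: OO_opp.
  - exact: OO_mul.
rewrite big_cat !big_map big_cons /= -Dr mulrBl !mulr_sumr -sumrN.
congr (_ + _); apply: eq_bigr => p _; first by rewrite mulrA.
by rewrite rmorphM; ring.
Qed.

Lemma trivial_inertia_unramified (P : L -> Prop) :
    lies_over K P Q ->
    (forall s, s \in G -> s != 1%g -> exists2 z, OE z & ~ Q (s z - z)) ->
  ramification_index E P Q 1.
Proof.
move=> PQ ex_z.
have PO_O x : ideal_ext OE P x -> OE x.
  case=> n [u [v [Pu Ov ->]]]; apply: OO_sum => i _.
  by apply: OO_mul; [apply: prime_OO; have /PQ[] := Pu i | apply: Ov].
have QkO k y : ideal_exp OE Q k y -> OE y.
  elim: k y => // k IH y [l [a [b [Qa Qb ->]]]].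
  by apply: OO_sum => o _; apply: OO_mul; [exact/prime_OO/Qa | exact/IH/Qb].
rewrite /ramification_index => -[|[|k]].
- by split=> // _ x /PO_O.
- split=> // _ x [n [u [v [Pu Ov ->]]]]; exists n, u, v; split=> // i.
  by have /PQ[] := Pu i.
(* An exponent above 1 puts P O_E inside Q^2, the case to be refuted. *)
split=> // POQ; have {}POQ x : ideal_ext OE P x -> ideal_mul Q Q x.
  case/POQ=> n [u [v [Qu Qv ->]]]; exists n, u, v; split=> // i.
  case: (Qv i) => m [u' [v' [Qu' Qv' ->]]]; apply: prime_sum => j _.
  by apply: prime_mulr => //; apply: QkO (Qv' j).
exfalso; clear k.
have [z zP] : exists z : gal_of E -> L, forall s, s \in G -> s != 1%g ->
    OE (z s) /\ ~ Q (s (z s) - z s).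
  apply: (@fin_all_exists (gal_of E) (fun _ => L) (fun s z => s \in G -> s != 1%g ->
    OE z /\ ~ Q (s z - z))) => s.
  have [Gs|?] := boolP (s \in G); last by exists 0.
  have [->|nt_s] := eqVneq s 1%g; first by exists 0.
  by have [z ? ?] := ex_z s Gs nt_s; exists z.
pose ss := enum (G :\ 1%g).
have ssP s : s \in ss -> s \in G /\ s != 1%g.
  by rewrite mem_enum !inE => /andP[].
have [|r [Or Dr]] := @exists_separating_tensor z ss.
  by move=> s /ssP[Gs nt_s]; have [] := zP s Gs nt_s.
(* [d] is the value of the separating tensor at the identity; at any other element of the group one
   factor is 0. *)
pose d := \prod_(s <- ss) (s (z s) - z s).
have [Od Qd] : OE d /\ ~ Q d.
  rewrite /d big_seq; split.
    apply: OO_prod => s /ssP[Gs nt_s]; have [Oz _] := zP s Gs nt_s.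
    by apply: OO_sub => //; apply: OO_gal.
  apply: prime_prod_notin => s /ssP[Gs nt_s]; have [Oz ?] := zP s Gs nt_s => //.
  by apply: OO_sub => //; apply: OO_gal.
have Drd s : s \in G -> \sum_(p <- r) p.1 * s p.2 = if s == 1%g then d else 0.
  move=> Gs; rewrite Dr; case: eqP => [-> | /eqP nt_s].
    by apply: eq_big_seq => s' /ssP[Gs' nt_s']; rewrite gal_id.
  by rewrite (big_rem s) /= ?subrr ?mul0r // mem_enum !inE nt_s.
have d_tr x : \sum_(p <- r) p.1 * galTrace K E (p.2 * x) = d * x.
  under eq_bigr do rewrite /galTrace mulr_sumr.
  rewrite exchange_big /= (eq_bigr (fun s : gal_of E => (if s == 1%g then d else 0) * s x)).
    rewrite (bigD1 1%g) ?group1 //= eqxx gal_id big1 ?addr0 // => s /andP[_ /negPf->].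
    by rewrite mul0r.
  move=> s Gs; rewrite -Drd // mulr_suml; apply: eq_bigr => p _.
  by rewrite rmorphM mulrA.
have [c [Oc Qc QGc]] := exists_avoiding_conj.
have /(prime_or Od Oc)[] // : Q (d * c).
apply: prime_of_mul_sub => [|x Qx]; first exact: OO_mul.
apply: POQ; rewrite -mulrA -d_tr.
exists (size r), (fun i => galTrace K E ((nth (0, 0) r i).2 * (c * x))).
exists (fun i => (nth (0, 0) r i).1); split=> [i|i|].
(* The trace lies in K, and in Q because every conjugate of [c * x] does; hence in P. *)
- apply/PQ; have [|Or1 Or2] := Or (nth (0, 0) r i); first exact: mem_nth.
  split; first apply: mem_galTrace => //.
    rewrite rpredM //; first by case: Or2.
    by have [] := OO_mul Oc (prime_OO Qx).
  apply: prime_sum => s Gs; rewrite rmorphM; apply: prime_mull; last exact: QGc.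
  exact: OO_gal.
- by have [|] := Or (nth (0, 0) r i); first exact: mem_nth.
by rewrite (big_nth (0, 0)) big_mkord; apply: eq_bigr => i _; rewrite mulrC.
Qed.

End Ramification.

(** * Total inertia in degree five *)

Section TotalInertia.

Variables (L : splittingFieldType rat) (K E : {subfield L}) (Q : L -> Prop).
Hypotheses (prQ : nonzero_prime E Q) (galKE : galois K E).
Hypothesis (card_Gal : #|'Gal(E / K)%g| = 5%N).

Let OE := ring_of_integers E.

Hypothesis inertia : forall (s : gal_of E) x, s \in 'Gal(E / K)%g -> OE x -> Q (s x - x).

(** As z has degree 5 over K, the given monic quintic is its minimal polynomial there; the
    conclusions compare its coefficients with those of (X - z)^5. *)
Lemma inertia_quintic (z : L) (c0 c1 c2 c3 c4 : int) :
    <<K; z>>%VS = E ->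
    z ^+ 5 + c4%:~R * z ^+ 4 + c3%:~R * z ^+ 3 + c2%:~R * z ^+ 2 + c1%:~R * z
      + c0%:~R = 0 ->
  OE z /\ [/\ Q (c4%:~R + 5 * z), Q (c3%:~R - 10 * z ^+ 2),
    Q (c2%:~R + 10 * z ^+ 3) & Q (c1%:~R - 5 * z ^+ 4)].
Proof.
move=> defE gz0.
pose q : {poly int} := \poly_(i < 6) [:: c0; c1; c2; c3; c4; 1]`_i.
have size_q : size q = 6%N by apply: size_poly_eq.
have mon_q : q \is monic by rewrite monicE lead_coefE size_q coef_poly.
pose p : {poly L} := map_poly intr q.
have size_p : size p = 6%N by rewrite size_map_inj_poly //; apply: intr_ext_inj.
have mon_p : p \is monic by rewrite monic_map.
have pz0 : root p z.
  apply/rootP; rewrite (horner_coef_wide _ (eq_leq size_p)); apply: etrans gz0.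
  by rewrite !big_ord_recr big_ord0 /= !coef_map !coef_poly /=; ring.
have Oz : OE z.
  by split; [rewrite -defE memv_adjoin | exists q].
split=> //.
have sKE : (K <= E)%VS by case/and3P: galKE.
have deg_z : adjoin_degree K z = 5%N.
  by rewrite adjoin_degreeE defE (galois_dim galKE).
have Dp : minPoly K z = p.
  apply/eqP; rewrite -eqp_monic ?monic_minPoly // -dvdp_size_eqp.
    by rewrite size_minPoly deg_z size_p.
  apply: minPoly_dvdp => //; apply/polyOverP=> i.
  by rewrite coef_map rpred_int.
have [r [Gr _]] := galois_factors sKE galKE z Oz.1.
set bs := map _ _; rewrite Dp => Dpr.
have size_bs : size bs = 5%N.
  by apply: succn_inj; rewrite -(size_prod_XsubC bs id) -Dpr size_p.
have bsP b : b \in bs -> prime_congr E Q b z.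
  case/mapP=> s /(subsetP Gr) Gs ->; split=> //; first exact: OO_gal.
  exact: inertia.
have coefP : forall i, prime_congr E Q p`_i (('X - z%:P) ^+ 5)`_i.
  rewrite Dpr -size_bs; clear -bsP prQ Oz.
  elim: bs bsP => [|b bs IH] bsP i; first by rewrite big_nil expr0; apply: congr_refl;
    rewrite // coef1; case: eqP => _; [apply: OO1 | apply: OO0].
  rewrite big_cons exprS !mulrBl !coefB !coefCM !coefXM.
  have {}IH : forall j, prime_congr E Q
      (\prod_(b <- bs) ('X - b%:P))`_j (('X - z%:P) ^+ size bs)`_j.
    by apply: IH => b' bs_b'; apply: bsP; rewrite inE bs_b' orbT.
  have bz := bsP b (mem_head _ _).
  have congr_opp x y : prime_congr E Q x y -> prime_congr E Q (- x) (- y).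
    move=> xy; rewrite -(mulN1r x) -(mulN1r y); apply: congr_mul => //.
    by apply: congr_refl => //; apply/OO_opp/OO1.
  apply: congr_add => //; last by apply: congr_opp; apply: congr_mul.
  by case: eqP => _ //; apply: congr_refl => //; apply: OO0.
have exp5 : ('X - z%:P) ^+ 5 = 'X^5 - (5 * z) *: 'X^4 + (10 * z ^+ 2) *: 'X^3
    - (10 * z ^+ 3) *: 'X^2 + (5 * z ^+ 4) *: 'X - (z ^+ 5)%:P.
  by rewrite -!mul_polyC ?polyC_exp; ring.
have coefq i : p`_i = (q`_i)%:~R by rewrite coef_map.
move: coefP; rewrite exp5 => coefP; split.
- have [_ _] := coefP 4; rewrite coefq coef_poly /= !coefE /= => Qd.
  by apply: (eq_ind _ Q Qd); ring.
- have [_ _] := coefP 3; rewrite coefq coef_poly /= !coefE /= => Qd.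
  by apply: (eq_ind _ Q Qd); ring.
- have [_ _] := coefP 2; rewrite coefq coef_poly /= !coefE /= => Qd.
  by apply: (eq_ind _ Q Qd); ring.
- have [_ _] := coefP 1; rewrite coefq coef_poly /= !coefE /= => Qd.
  by apply: (eq_ind _ Q Qd); ring.
Qed.

Lemma intr_prime_coprime (a b : int) : coprimez a b -> Q a%:~R -> Q b%:~R -> False.
Proof.
move=> /coprimezP[[u v] /= uv] Qa Qb; apply: (prime1 prQ).
have -> : 1 = u%:~R * a%:~R + v%:~R * b%:~R :> L by rewrite -!rmorphM -rmorphD /= uv.
by apply: (prime_add prQ); apply: (prime_mull prQ) => //; apply: intr_OO.
Qed.

Lemma intr_prime_or (a b : int) : Q (a * b)%:~R -> Q a%:~R \/ Q b%:~R.
Proof. by rewrite rmorphM; apply: (prime_or prQ); apply: intr_OO. Qed.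

(* Away from 5 the conjugates of x cannot all agree modulo Q, and
   above 5 total inertia would make the trace -c4 of z divisible by 5. *)
Lemma no_total_inertia (t : int) (x z : L) (c0 c1 c2 c3 c4 : int) :
    <<K; x>>%VS = E -> <<K; z>>%VS = E ->
    x ^+ 5 - 10 * x ^+ 3 + 5 * (4 + 4 * t + 2 * t ^+ 2 + t ^+ 3)%:~R * x ^+ 2
      - 5 * (3 + 8 * t + 4 * t ^+ 2 + 2 * t ^+ 3 + t ^+ 4)%:~R * x
      + (4 + 20 * t + 26 * t ^+ 2 + 13 * t ^+ 3 + 6 * t ^+ 4 + 2 * t ^+ 5)%:~R = 0 ->
    z ^+ 5 + c4%:~R * z ^+ 4 + c3%:~R * z ^+ 3 + c2%:~R * z ^+ 2 + c1%:~R * z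
      + c0%:~R = 0 ->
    ~~ (5 %| c4)%Z ->
  False.
Proof.
move=> defE_x defE_z px0 pz0 c4_5.
have [Q5 | Q5] := classic (Q (5 : int)%:~R).
  have [Oz [Qc4 _ _ _]] := inertia_quintic defE_z pz0.
  apply: (@intr_prime_coprime 5 c4) => //.
    by rewrite /coprimez -[gcdz _ _]/(gcdn 5 `|c4|)%:Z eqz_nat -/(coprime 5 _) prime_coprime.
  have -> : c4%:~R = c4%:~R + 5 * z - (5 : int)%:~R * z by ring.
  by apply: (prime_sub prQ) => //; apply: (prime_mulr prQ).
(* With 5 outside Q, the coefficients of X^4, X^3, X^2 and X successively put x, 2, t and 3 in Q,
   but 2 and 3 are coprime. *)
have [|Ox [Q4 Q3 Q2 Q1]] := @inertia_quintic x
  (4 + 20 * t + 26 * t ^+ 2 + 13 * t ^+ 3 + 6 * t ^+ 4 + 2 * t ^+ 5)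
  (- 5 * (3 + 8 * t + 4 * t ^+ 2 + 2 * t ^+ 3 + t ^+ 4))
  (5 * (4 + 4 * t + 2 * t ^+ 2 + t ^+ 3)) (- 10) 0 defE_x.
  by rewrite -px0; ring.
have Qx : Q x.
  move: Q4; rewrite add0r => /(prime_or prQ (intr_OO E 5) Ox)[] //.
have QxM a b : OE a -> Q (b + a * x) -> Q b.
  move=> Oa Qb; have -> : b = b + a * x - a * x by ring.
  by apply: (prime_sub prQ) => //; apply: (prime_mull prQ).
have O_ (k : int) n : OE (k%:~R * x ^+ n) by apply: OO_mul; [apply: intr_OO | apply: OO_exp].
have {}Q3 : Q (2 : int)%:~R.
  have /intr_prime_or[] // : Q (5 * (- 2))%:~R.
    by apply: (QxM ((-10)%:~R * x ^+ 1) _ (O_ _ _)); apply: (eq_ind _ Q Q3); ring.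
  by move=> Q2'; rewrite -[2%:~R]opprK; apply: (prime_opp prQ); rewrite -rmorphN.
have Q2M a b : Q (b + 2 * a)%:~R -> Q b%:~R.
  move=> Qb; have -> : b%:~R = (b + 2 * a)%:~R - (2 : int)%:~R * a%:~R :> L by ring.
  by apply: (prime_sub prQ) => //; apply: (prime_mulr prQ) => //; apply: intr_OO.
have Qt : Q t%:~R.
  have /intr_prime_or[] // : Q (5 * (4 + 4 * t + 2 * t ^+ 2 + t ^+ 3))%:~R.
    by apply: (QxM (10%:~R * x ^+ 2) _ (O_ _ _)); apply: (eq_ind _ Q Q2); ring.
  move=> Qt3; apply: (@prime_exp _ _ _ prQ _ 3 (intr_OO E t)).
  rewrite -rmorphXn; apply: (Q2M (2 + 2 * t + t ^+ 2)).
  by apply: (eq_ind _ (fun k : int => Q k%:~R) Qt3); ring.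
have /intr_prime_or[] // : Q (5 * (3 + 8 * t + 4 * t ^+ 2 + 2 * t ^+ 3 + t ^+ 4))%:~R.
  rewrite -[_%:~R]opprK; apply: (prime_opp prQ).
  by apply: (QxM ((-5)%:~R * x ^+ 3) _ (O_ _ _)); apply: (eq_ind _ Q Q1); ring.
move=> Q3'; apply: (@intr_prime_coprime 2 3) => //.
have -> : 3%:~R = (3 + 8 * t + 4 * t ^+ 2 + 2 * t ^+ 3 + t ^+ 4)%:~R
   - (8 + 4 * t + 2 * t ^+ 2 + t ^+ 3)%:~R * t%:~R :> L by ring.
by apply: (prime_sub prQ) => //; apply: (prime_mull prQ) => //; apply: intr_OO.
Qed.

End TotalInertia.

(** * Integral generators with trace prime to 5 *)

Section IntegralGenerator.

Variable L : splittingFieldType rat.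

Lemma intr_ext_neq0 (k : int) : k != 0 -> k%:~R != 0 :> L.
Proof. by rewrite intr_ext_eq0. Qed.

Definition five_adic_generator (x : L) : Prop :=
  exists z : L, exists c0 c1 c2 c3 c4 : int,
    [/\ z \in <<1; x>>%VS, x \in <<1; z>>%VS,
      z ^+ 5 + c4%:~R * z ^+ 4 + c3%:~R * z ^+ 3 + c2%:~R * z ^+ 2 + c1%:~R * z
        + c0%:~R = 0
      & ~~ (5 %| c4)%Z].

(** The equation is required for every u with x = a + 5 u, so that it can be checked by substituting
    for x. *)
Lemma scaled_generator (x : L) (a c0 c1 c2 c3 c4 : int) :
    (forall u : L, x = a%:~R + 5 * u -> u ^+ 5 + c4%:~R * u ^+ 4 + c3%:~R * u ^+ 3
      + c2%:~R * u ^+ 2 + c1%:~R * u + c0%:~R = 0) ->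
    ~~ (5 %| c4)%Z ->
  five_adic_generator x.
Proof.
move=> Hu c4_5; have nz5 : (5 : L) != 0 by apply: (@intr_ext_neq0 5).
have Dx : x = a%:~R + 5 * ((x - a%:~R) / 5) by field.
have := memv_adjoin 1 x; have := memv_adjoin 1 ((x - a%:~R) / 5).
set z := _ / 5 in Dx *; move=> zz xx.
exists z, c0, c1, c2, c3, c4; split=> //; last exact: Hu.
  by rewrite rpred_div ?rpred_nat // rpredB ?rpred_int.
by rewrite Dx rpredD ?rpred_int // rpredM ?rpred_nat.
Qed.

(** Inversion reverses the coefficients: the trace of b/(x - a) comes from the linear and constant
    coefficients of the quintic expanded at a. This serves when (x - a)/5 is not integral. *)
Lemma inverse_generator (x : L) (a b c0 c1 c2 c3 c4 : int) :
    b != 0 -> x != a%:~R ->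
    (forall z : L, z != 0 -> x = a%:~R + b%:~R / z -> z ^+ 5 + c4%:~R * z ^+ 4
      + c3%:~R * z ^+ 3 + c2%:~R * z ^+ 2 + c1%:~R * z + c0%:~R = 0) ->
    ~~ (5 %| c4)%Z ->
  five_adic_generator x.
Proof.
move=> nz_b; rewrite -subr_eq0 => nz_xa Hz c4_5.
have nz_bL : b%:~R != 0 :> L by apply: intr_ext_neq0.
have Dx : x = a%:~R + b%:~R / (b%:~R / (x - a%:~R)) by field; rewrite ?nz_xa ?nz_bL.
have := memv_adjoin 1 x; have := memv_adjoin 1 (b%:~R / (x - a%:~R)).
set z := _ / (_ - _) in Dx *; move=> zz xx.
exists z, c0, c1, c2, c3, c4; split=> //.
- by rewrite rpred_div ?rpred_int // rpredB ?rpred_int.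
- by rewrite Dx rpredD ?rpred_int // rpred_div ?rpred_int.
- by apply: Hz; rewrite // mulf_neq0 ?invr_eq0.
Qed.

(** The coefficients of X^3, X^2 and X are divisible by 5, so the quintic is a fifth power (X - a)^5
    modulo 5. The shift used in each case is this root: 3 for t = 7 modulo 25, 1 for t = 0 modulo
    125, and -1 in the other classes. Absence of integer roots allows division by x - a and by the
    constant term at a. *)
Lemma exists_five_adic_generator (t : int) (x : L) :
    admissible t ->
    (forall k : int, k ^+ 5 - 10 * k ^+ 3 + 5 * (4 + 4 * t + 2 * t ^+ 2 + t ^+ 3) * k ^+ 2
      - 5 * (3 + 8 * t + 4 * t ^+ 2 + 2 * t ^+ 3 + t ^+ 4) * k
      + (4 + 20 * t + 26 * t ^+ 2 + 13 * t ^+ 3 + 6 * t ^+ 4 + 2 * t ^+ 5) != 0) ->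
    x ^+ 5 - 10 * x ^+ 3 + 5 * (4 + 4 * t + 2 * t ^+ 2 + t ^+ 3)%:~R * x ^+ 2
      - 5 * (3 + 8 * t + 4 * t ^+ 2 + 2 * t ^+ 3 + t ^+ 4)%:~R * x
      + (4 + 20 * t + 26 * t ^+ 2 + 13 * t ^+ 3 + 6 * t ^+ 4 + 2 * t ^+ 5)%:~R = 0 ->
  five_adic_generator x.
Proof.
move=> adm_t no_root px0.
have x_nint k : x != k%:~R.
  apply: contra (no_root k) => /eqP Dx; rewrite -(intr_ext_eq0 L); apply/eqP.
  by rewrite -px0 Dx; ring.
have nz5 : (5 : L) != 0 by apply: (@intr_ext_neq0 5).
have modE (d a : int) : (t = a %[mod d])%Z -> exists k : int, t = a + d * k.
  move=> /eqP; rewrite eqz_mod_dvd => /dvdzP[k Dk]; exists k.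
  by rewrite mulrC -Dk addrC subrK.
(* With Y = x + 1, p is Y^5 - 5 Y^4 + (t^2 + 4) (5 (t + 2) Y^2 - 5 (t + 2)^2 Y
   + (t + 2)^2 (2 t + 3)). *)
have of_t2_add4 (m0 m1 m2 : int) :
    (t ^+ 2 + 4) * (t + 2) = 25 * m2 -> (t ^+ 2 + 4) * (t + 2) ^+ 2 = 125 * m1 ->
    (t ^+ 2 + 4) * (t + 2) ^+ 2 * (2 * t + 3) = 3125 * m0 ->
    five_adic_generator x.
  move=> /(congr1 (intr : int -> L)) D2 /(congr1 (intr : int -> L)) D1.
  move=> /(congr1 (intr : int -> L)) D0.
  apply: (@scaled_generator x (-1) m0 (- m1) m2 0 (-1)) => // u Dx.
  apply: (mulfI (expf_neq0 5 nz5)); rewrite mulr0 -px0 Dx.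
  transitivity (5 ^+ 5 * u ^+ 5 - 5 ^+ 5 * u ^+ 4 + 125 * (25 * m2)%:~R * u ^+ 2
    - 25 * (125 * m1)%:~R * u + (3125 * m0)%:~R); first by ring.
  by rewrite -D2 -D1 -D0; ring.
case: adm_t => [[]|[]|] /modE[k Dt].
- (* With Z = x - 3, p is Z^5 + 15 Z^4 + 80 Z^3 + 5 e2 Z^2 + 5 d1 Z + 25 d0. *)
  pose d0 := k * (2 * t ^+ 4 + 5 * t ^+ 3 + 63 * t ^+ 2 + 497 * t + 3559) + 1001.
  pose d1 := - t ^+ 4 + 4 * t ^+ 3 + 8 * t ^+ 2 + 16 * t + 48.
  pose e2 := t ^+ 3 + 2 * t ^+ 2 + 4 * t + 40.
  (* The right-hand side is the value of the quintic at 3. *)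
  have D0 : 25 * d0 = 2 * t ^+ 5 - 9 * t ^+ 4 + 28 * t ^+ 3 + 56 * t ^+ 2 + 80 * t + 112.
    by rewrite /d0 Dt; ring.
  have nz_d0 : d0 != 0.
    apply: contra (no_root 3) => /eqP d0_0; move: D0; rewrite d0_0 mulr0 => D0.
    by apply/eqP; rewrite [RHS]D0; ring.
  apply: (@inverse_generator x 3 (5 * d0) (125 * d0 ^+ 4) (375 * d0 ^+ 3) (400 * d0 ^+ 2)
    (5 * e2 * d0) d1) => //.
  + by rewrite mulf_neq0.
  + move=> z nz_z Dx; have nz_d0L := intr_ext_neq0 nz_d0.
    apply: (mulfI (mulf_neq0 (expf_neq0 2 nz5) nz_d0L)); rewrite mulr0.
    transitivity (z ^+ 5 * 0); last by rewrite mulr0.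
    rewrite -px0 Dx.
    have E0 : (2 * t ^+ 5 - 9 * t ^+ 4 + 28 * t ^+ 3 + 56 * t ^+ 2 + 80 * t + 112)%:~R
      = 25 * d0%:~R :> L by rewrite -D0; ring.
    transitivity (z ^+ 5 * ((5 * d0%:~R / z) ^+ 5 + 15 * (5 * d0%:~R / z) ^+ 4
      + 80 * (5 * d0%:~R / z) ^+ 3 + 5 * e2%:~R * (5 * d0%:~R / z) ^+ 2
      + 5 * d1%:~R * (5 * d0%:~R / z) + 25 * d0%:~R)); first by field.
    by congr (_ * _); rewrite -E0 /e2 /d1; ring.
  (* Now t = 2 + 5 j, and at t = 2 the value of [d1] is 128, which is 3 modulo 5. *)
  pose j := 1 + 5 * k.
  have -> : d1 = 5 * (25 + 64 * j + 40 * j ^+ 2 - 100 * j ^+ 3 - 125 * j ^+ 4) + 3.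
    by rewrite /d1 /j Dt; ring.
  by rewrite rpredDl ?dvdz_mulr.
- pose m := 5 + 22 * k + 25 * k ^+ 2; pose q := 13 + 25 * k.
  have Dm : t ^+ 2 + 4 = 25 * m by rewrite /m Dt; ring.
  have Dq : t + 2 = q by rewrite /q Dt; ring.
  have Dq2 : 2 * t + 3 = 25 * (1 + 2 * k) by rewrite Dt; ring.
  (* Modulo 5, [m] is 2 k and [q] is 3, so 125 divides (t^2 + 4)(t + 2)^2 exactly when 5 divides
     k. *)
  have [/dvdzP[j Dk] | k5] := boolP (5 %| k)%Z.
    have Dm' : m = 5 * (1 + 22 * j + 125 * j ^+ 2) by rewrite /m Dk; ring.
    apply: (@of_t2_add4 ((1 + 22 * j + 125 * j ^+ 2) * q ^+ 2 * (1 + 2 * k))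
      ((1 + 22 * j + 125 * j ^+ 2) * q ^+ 2) (m * q)); rewrite Dm Dq ?Dq2 ?Dm'; ring.
  (* Here Y = 5 u with u^5 - u^4 + m q u^2 - (m q^2 u - a0) / 5 = 0. *)
  pose a0 := m * q ^+ 2 * (1 + 2 * k).
  have c4_5 : ~~ (5 %| - (m * q ^+ 2))%Z.
    rewrite rpredN !dvdzE !abszM !Euclid_dvdM // -!(dvdzE 5).
    by rewrite /m /q; move: k5; lia.
  have nz_a0 : a0 != 0.
    rewrite mulf_neq0 //; last by lia.
    by apply: contra c4_5 => /eqP->.
  apply: (@inverse_generator x (-1) (5 * a0) (5 * a0 ^+ 4) (- 5 * a0 ^+ 3) 0
    (5 * m * q * a0) (- (m * q ^+ 2))) => //.
    by rewrite mulf_neq0.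
  move=> z nz_z Dx; have nz_a0L := intr_ext_neq0 nz_a0.
  apply: (mulfI (mulf_neq0 (expf_neq0 4 nz5) nz_a0L)); rewrite mulr0.
  transitivity (z ^+ 5 * 0); last by rewrite mulr0.
  rewrite -px0 Dx.
  transitivity (z ^+ 5 * ((5 * a0%:~R / z) ^+ 5 - 5 * (5 * a0%:~R / z) ^+ 4
    + (25 * m)%:~R * (5 * q%:~R * (5 * a0%:~R / z) ^+ 2
      - 5 * q%:~R ^+ 2 * (5 * a0%:~R / z) + q%:~R ^+ 2 * (25 * (1 + 2 * k))%:~R))).
    by rewrite /a0; field.
  by congr (_ * _); rewrite -Dm -Dq -Dq2; ring.
- apply: (@of_t2_add4 (5 * (t ^+ 2 + 4) * k ^+ 2 * (2 * t + 3)) (125 * (t ^+ 2 + 4) * k ^+ 2)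
    (5 * (t ^+ 2 + 4) * k)); rewrite Dt; ring.
- apply: (@scaled_generator x 1 (5 * k ^+ 2 * (16 + 8 * t + t ^+ 2 + 2 * t ^+ 3))
    (- (k * t ^+ 3)) (5 * k * (4 + 2 * t + t ^+ 2)) 0 1) => // u Dx.
  by apply: (mulfI (expf_neq0 5 nz5)); rewrite mulr0 -px0 Dx Dt; ring.
(* 989 is a square root of -4 modulo 3125; the opposite root is 11 modulo 25 and falls under an
   earlier case. *)
pose m := 313 + 1978 * k + 3125 * k ^+ 2.
have Dm : t ^+ 2 + 4 = 3125 * m by rewrite /m Dt; ring.
by apply: (@of_t2_add4 (m * (t + 2) ^+ 2 * (2 * t + 3)) (25 * m * (t + 2) ^+ 2)
  (125 * m * (t + 2))); rewrite Dm; ring.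
Qed.

End IntegralGenerator.

(** * Factorisation of the quintic *)

Section QuinticFactorisation.

Variable F : fieldType.
Implicit Types t x r w : F.

(** This is the quintic p of the theorem evaluated at [x + 1]. *)
Definition shifted_quintic t x : F :=
  x ^+ 5 + 5 * x ^+ 4 + 5 * t * (t ^+ 2 + 2 * t + 4) * x ^+ 2 - 5 * t ^+ 4 * x
    + t ^+ 2 * (16 + 8 * t + t ^+ 2 + 2 * t ^+ 3).

Let den t : F := 2 * t * (t ^+ 2 + 4) * (t + 2) * (11 * t + 4).

(* Over Q(t, w) the five roots form a pentagon.  With w^2 = 5(t^2+4) and
   y^2 = t(t+2)w(t-4-w)/2, the two neighbours of the root x have sum
   -(x+5)/2 + w fac_a, product fac_b + w fac_c and difference y(fac_d + w fac_e);
   these expressions in x were found by interpolation. *)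
Definition fac_a t x : F :=
  ((80 * t + 180 * t ^+ 2 + 78 * t ^+ 3 + 33 * t ^+ 4 + 34 * t ^+ 5)
    + (- 16 * t - 156 * t ^+ 2 - 86 * t ^+ 3 - 47 * t ^+ 4) * x
    + (40 + 70 * t + 6 * t ^+ 2 + 4 * t ^+ 3) * x ^+ 2
    + (8 - 36 * t - 2 * t ^+ 2) * x ^+ 3
    + (- 10 * t) * x ^+ 4)
  / (den t).

Definition fac_b t x : F :=
  ((- 160 * t ^+ 3 - 55 * t ^+ 4 + 35 * t ^+ 5)
    + (- 120 * t - 340 * t ^+ 2 - 245 * t ^+ 3 - 105 * t ^+ 4) * x
    + (16 * t - 43 * t ^+ 2 - 3 * t ^+ 3) * x ^+ 2
    + (- 50 - 100 * t - 15 * t ^+ 2) * x ^+ 3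
    + (- 10 - 20 * t) * x ^+ 4)
  / (2 * t * (t + 2) * (11 * t + 4)).

Definition fac_c t x : F :=
  ((16 * t ^+ 3 + 14 * t ^+ 4 - 23 * t ^+ 5 - 7 * t ^+ 6)
    + (80 * t + 280 * t ^+ 2 + 212 * t ^+ 3 + 107 * t ^+ 4 + 21 * t ^+ 5) * x
    + (10 * t ^+ 2 + 15 * t ^+ 3 + 5 * t ^+ 4) * x ^+ 2
    + (20 + 60 * t + 22 * t ^+ 2 + 3 * t ^+ 3) * x ^+ 3
    + (4 + 12 * t + 4 * t ^+ 2) * x ^+ 4)
  / (den t).

Definition fac_d t x : F :=
  ((144 * t ^+ 2 + 76 * t ^+ 3 + 89 * t ^+ 4 + 34 * t ^+ 5 + 17 * t ^+ 6)
    + (- 160 * t - 358 * t ^+ 2 - 270 * t ^+ 3 - 107 * t ^+ 4 - 40 * t ^+ 5) * x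
    + (88 * t + 23 * t ^+ 2 + 7 * t ^+ 3 + 2 * t ^+ 4) * x ^+ 2
    + (- 50 - 34 * t - 20 * t ^+ 2 - t ^+ 3) * x ^+ 3
    + (- 10 - 10 * t - 5 * t ^+ 2) * x ^+ 4)
  / (den t * t * (t + 1)).

Definition fac_e t x : F :=
  ((- 80 * t ^+ 2 - 92 * t ^+ 3 - 79 * t ^+ 4 - 56 * t ^+ 5 - 17 * t ^+ 6)
    + (80 * t + 206 * t ^+ 2 + 186 * t ^+ 3 + 77 * t ^+ 4 + 18 * t ^+ 5) * x
    + (- 48 * t - 39 * t ^+ 2 - 7 * t ^+ 3 - 2 * t ^+ 4) * x ^+ 2
    + (30 + 42 * t + 20 * t ^+ 2 + t ^+ 3) * x ^+ 3
    + (6 + 10 * t + 5 * t ^+ 2) * x ^+ 4)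
  / (den t * t * (t + 1) * (t + 2)).

(** The first quadratic has the two neighbours of x as roots, the second the two other roots. They
    differ by the sign of w, so their product involves only w^2, and what remains is an identity
    modulo the quintic in x. *)
Lemma shifted_quintic_factor t x r w :
    2 != 0 :> F -> t != 0 -> t + 2 != 0 -> t ^+ 2 + 4 != 0 -> 11 * t + 4 != 0 ->
    w ^+ 2 = 5 * (t ^+ 2 + 4) -> shifted_quintic t x = 0 ->
  shifted_quintic t r = (r - x)
    * (r ^+ 2 + (x + 5) / 2 * r + fac_b t x - w * (fac_a t x * r - fac_c t x))
    * (r ^+ 2 + (x + 5) / 2 * r + fac_b t x + w * (fac_a t x * r - fac_c t x)).
Proof.
move=> nz2 nz_t nz_t2 nz_t4 nz_t11 Dw px0; apply/eqP; rewrite -subr_eq0; apply/eqP.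
(* The cofactors below come from polynomial division by the quintic; numerals being
   unary, large coefficients are written in base 1000. *)
transitivity (shifted_quintic t x * (1 + (r - x) / den t ^+ 2 *
     (20 * (
      (- 1328 * t ^+ 4 - 604 * t ^+ 5 - 760 * t ^+ 6 - 491 * t ^+ 7 - 107 * t ^+ 8 - 85
        * t ^+ 9)
      + (256 * t - 96 * t ^+ 2 - 936 * t ^+ 3 + 140 * t ^+ 4 - 354 * t ^+ 5 + 21 * t ^+
        6 - 26 * t ^+ 7 - 5 * t ^+ 8) * x
      + (- 320 - 1120 * t - 1124 * t ^+ 2 - 608 * t ^+ 3 - 553 * t ^+ 4 - 178 * t ^+ 5 -
        73 * t ^+ 6 - 24 * t ^+ 7) * x ^+ 2
      + (- 64 - 224 * t - 180 * t ^+ 2 - 40 * t ^+ 3 - 105 * t ^+ 4 + 4 * t ^+ 5 - 16 *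
        t ^+ 6) * x ^+ 3
      + (256 * t + 2144 * t ^+ 2 + (5 * 1000 + 144) * t ^+ 3 + 4060 * t ^+ 4 + 3286 * t
        ^+ 5 + 1361 * t ^+ 6 + 504 * t ^+ 7 + 120 * t ^+ 8) * r
      + (- 320 - 1520 * t - 2160 * t ^+ 2 - 1020 * t ^+ 3 - 440 * t ^+ 4 - 80 * t ^+ 5 +
        20 * t ^+ 6 + 20 * t ^+ 7) * x * r
      + (- 64 + 96 * t + 800 * t ^+ 2 + 400 * t ^+ 3 + 280 * t ^+ 4 + 94 * t ^+ 5 + 19 *
        t ^+ 6) * x ^+ 2 * r
      + (80 * t + 240 * t ^+ 2 + 100 * t ^+ 3 + 60 * t ^+ 4 + 20 * t ^+ 5) * x ^+ 3 * r
      + (320 + 1120 * t + 1476 * t ^+ 2 + 1632 * t ^+ 3 + 1137 * t ^+ 4 + 762 * t ^+ 5 +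
        197 * t ^+ 6 + 106 * t ^+ 7) * r ^+ 2
      + (64 - 576 * t - 1220 * t ^+ 2 - 320 * t ^+ 3 - 385 * t ^+ 4 - 44 * t ^+ 5 - 19 *
        t ^+ 6) * x * r ^+ 2
      + (- 160 * t + 220 * t ^+ 2 + 55 * t ^+ 4 + 10 * t ^+ 5) * x ^+ 2 * r ^+ 2
      + (100 * t ^+ 2 + 25 * t ^+ 4) * x ^+ 3 * r ^+ 2)))); last by rewrite px0 !mul0r.
have -> g h : (r - x) * (g - w * h) * (g + w * h) = (r - x) * (g ^+ 2 - w ^+ 2 * h ^+ 2).
  by ring.
rewrite Dw /shifted_quintic /fac_a /fac_b /fac_c /den.
by field; rewrite ?nz2 ?nz_t ?nz_t2 ?nz_t4 ?nz_t11.
Qed.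

(** The discriminant is the squared difference of the two neighbours of x. Applied to -w and the
    conjugate of y, the same identity treats the other quadratic factor. *)
Lemma quadratic_factor_disc t x w y :
    2 != 0 :> F -> t != 0 -> t + 1 != 0 -> t + 2 != 0 -> t ^+ 2 + 4 != 0 -> 11 * t + 4 != 0 ->
    w ^+ 2 = 5 * (t ^+ 2 + 4) -> y ^+ 2 = t * (t + 2) * w * (t - 4 - w) / 2 ->
    shifted_quintic t x = 0 ->
  (- (x + 5) / 2 + w * fac_a t x) ^+ 2 - 4 * (fac_b t x + w * fac_c t x)
    = (y * (fac_d t x + w * fac_e t x)) ^+ 2.
Proof.
move=> nz2 nz_t nz_t1 nz_t2 nz_t4 nz_t11 Dw Dy px0; apply/eqP; rewrite -subr_eq0; apply/eqP.
(* Eliminating y and w^2 leaves an expression linear in w, which is then divided by the quintic. *)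
have red_w a b c d e f : (a + w * b) ^+ 2 - 4 * (c + w * d) - (y * (e + w * f)) ^+ 2
    = a ^+ 2 + 5 * (t ^+ 2 + 4) * b ^+ 2 - 4 * c + w * (2 * a * b - 4 * d)
      - t * (t + 2) / 2 * (2 * (t - 4) * (5 * (t ^+ 2 + 4)) * e * f
          - 5 * (t ^+ 2 + 4) * (e ^+ 2 + 5 * (t ^+ 2 + 4) * f ^+ 2)
        + w * ((t - 4) * (e ^+ 2 + 5 * (t ^+ 2 + 4) * f ^+ 2)
          - 2 * (5 * (t ^+ 2 + 4)) * e * f)).
  by rewrite exprMn Dy -Dw; field.
transitivity (shifted_quintic t x / (den t * t * (t + 1) * (t + 2)) ^+ 2 *
     (8 * (
      (4800 * t ^+ 2 + (39 * 1000 + 360) * t ^+ 3 + (129 * 1000 + 640) * t ^+ 4 + (248 *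
        1000 + 780) * t ^+ 5 + (321 * 1000 + 450) * t ^+ 6 + (301 * 1000 + 455) * t ^+ 7
        + (216 * 1000 + 295) * t ^+ 8 + (121 * 1000 + 490) * t ^+ 9 + (52 * 1000 + 650)
        * t ^+ 10 + (17 * 1000 + 385) * t ^+ 11 + 4165 * t ^+ 12 + 530 * t ^+ 13)
      + (- (5 * 1000 + 440) * t ^+ 2 - (31 * 1000 + 840) * t ^+ 3 - (84 * 1000 + 800) *
        t ^+ 4 - (129 * 1000 + 480) * t ^+ 5 - (124 * 1000 + 480) * t ^+ 6 - (82 * 1000
        + 660) * t ^+ 7 - (41 * 1000 + 825) * t ^+ 8 - (16 * 1000 + 230) * t ^+ 9 - 4360
        * t ^+ 10 - 790 * t ^+ 11 - 95 * t ^+ 12) * x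
      + (2000 * t + (10 * 1000 + 40) * t ^+ 2 + (20 * 1000 + 580) * t ^+ 3 + (26 * 1000
        + 970) * t ^+ 4 + (29 * 1000 + 200) * t ^+ 5 + (25 * 1000 + 115) * t ^+ 6 + (15
        * 1000 + 385) * t ^+ 7 + (7 * 1000 + 50) * t ^+ 8 + 2535 * t ^+ 9 + 575 * t ^+
        10 + 50 * t ^+ 11) * x ^+ 2
      + (400 * t + 2200 * t ^+ 2 + (5 * 1000 + 300) * t ^+ 3 + (8 * 1000 + 650) * t ^+ 4
        + (10 * 1000 + 700) * t ^+ 5 + (9 * 1000 + 225) * t ^+ 6 + (5 * 1000 + 350) * t
        ^+ 7 + 2300 * t ^+ 8 + 750 * t ^+ 9 + 125 * t ^+ 10) * x ^+ 3
      + (- 800 * t ^+ 2 - (7 * 1000 + 8) * t ^+ 3 - (23 * 1000 + 408) * t ^+ 4 - (41 *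
        1000 + 702) * t ^+ 5 - (46 * 1000 + 819) * t ^+ 6 - (37 * 1000 + 345) * t ^+ 7 -
        (22 * 1000 + 584) * t ^+ 8 - (10 * 1000 + 312) * t ^+ 9 - 3483 * t ^+ 10 - 833 *
        t ^+ 11 - 106 * t ^+ 12) * w
      + (800 * t ^+ 2 + 4272 * t ^+ 3 + (9 * 1000 + 920) * t ^+ 4 + (12 * 1000 + 988) *
        t ^+ 5 + (10 * 1000 + 768) * t ^+ 6 + (6 * 1000 + 227) * t ^+ 7 + 2654 * t ^+ 8
        + 794 * t ^+ 9 + 158 * t ^+ 10 + 19 * t ^+ 11) * x * w
      + (- 200 * t - 1140 * t ^+ 2 - 3020 * t ^+ 3 - 4700 * t ^+ 4 - 4635 * t ^+ 5 -
        3075 * t ^+ 6 - 1480 * t ^+ 7 - 525 * t ^+ 8 - 115 * t ^+ 9 - 10 * t ^+ 10) * x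
        ^+ 2 * w
      + (- 40 * t - 260 * t ^+ 2 - 780 * t ^+ 3 - 1340 * t ^+ 4 - 1405 * t ^+ 5 - 950 *
        t ^+ 6 - 450 * t ^+ 7 - 150 * t ^+ 8 - 25 * t ^+ 9) * x ^+ 3 * w))); last by rewrite px0 !mul0r.
rewrite red_w /shifted_quintic /fac_a /fac_b /fac_c /fac_d /fac_e /den.
by field; rewrite ?nz2 ?nz_t ?nz_t1 ?nz_t2 ?nz_t4 ?nz_t11.
Qed.

End QuinticFactorisation.

(** * The two polynomials and their roots in an extension *)

Section PolynomialRoots.

Variable L : splittingFieldType rat.
Implicit Types (x y : L) (t : int).

Lemma size_quartic t : size (quartic_poly t) = 5%N.
Proof.
rewrite /quartic_poly -addrA size_polyDl size_polyXn //.
rewrite (leq_ltn_trans (size_polyD _ _)) // gtn_max.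
rewrite (leq_ltn_trans (size_scale_leq _ _)) ?size_polyXn //.
by rewrite (leq_ltn_trans (size_polyC_leq1 _)).
Qed.

Lemma horner_quartic t y :
  (map_poly (in_alg L) (quartic_poly t)).[y] =
  let s : L := t%:~R in
  y ^+ 4 + 5 * (s + 2) * (s ^+ 2 + 4) * s * y ^+ 2
  + 5 * (s ^+ 2 + 4) * (s + 2) ^+ 2 * (s + 1) ^+ 2 * s ^+ 2.
Proof.
have size_p : (size (map_poly (in_alg L) (quartic_poly t)) <= 5)%N.
  by rewrite size_map_poly size_quartic.
rewrite (horner_coef_wide _ size_p) !big_ord_recr big_ord0 /= !coef_map /quartic_poly.
by rewrite !coefE /= -!in_algE; ring.
Qed.

Lemma monic_quartic t : quartic_poly t \is monic.
Proof.
rewrite monicE lead_coefE size_quartic /quartic_poly -addrA coefD coefXn eqxx.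
by rewrite coefD coefZ coefXn coefC /= mulr0 !addr0.
Qed.

Lemma quintic_polyE t : let s : rat := t%:~R in
  quintic_poly t = 'X^5 + (- 10 *: 'X^3 + (5 * (4 + 4 * s + 2 * s ^+ 2 + s ^+ 3)) *: 'X^2
    - (5 * (3 + 8 * s + 4 * s ^+ 2 + 2 * s ^+ 3 + s ^+ 4)) *: 'X
    + (4 + 20 * s + 26 * s ^+ 2 + 13 * s ^+ 3 + 6 * s ^+ 4 + 2 * s ^+ 5)%:P).
Proof.
move=> s; rewrite /quintic_poly -/s -!mul_polyC. ring.
Qed.

Lemma size_quintic t : size (quintic_poly t) = 6%N.
Proof.
rewrite quintic_polyE size_polyDl size_polyXn //.
rewrite (leq_trans _ (_ : 4 < 6)%N) // ltnS.
rewrite (leq_trans (size_polyD _ _)) // geq_max (leq_trans (size_polyC_leq1 _)) // andbT.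
rewrite (leq_trans (size_polyD _ _)) // geq_max size_polyN.
rewrite (leq_trans (size_scale_leq _ _)) ?size_polyX // andbT.
rewrite (leq_trans (size_polyD _ _)) // geq_max.
by rewrite !(leq_trans (size_scale_leq _ _)) ?size_polyXn.
Qed.

Lemma monic_quintic t : quintic_poly t \is monic.
Proof.
rewrite monicE lead_coefE size_quintic quintic_polyE !coefE /=.
by rewrite !mulr0 !(addr0, subr0).
Qed.

Lemma horner_quintic t x :
  (map_poly (in_alg L) (quintic_poly t)).[x] =
  x ^+ 5 - 10 * x ^+ 3 + 5 * (4 + 4 * t + 2 * t ^+ 2 + t ^+ 3)%:~R * x ^+ 2
      - 5 * (3 + 8 * t + 4 * t ^+ 2 + 2 * t ^+ 3 + t ^+ 4)%:~R * x
      + (4 + 20 * t + 26 * t ^+ 2 + 13 * t ^+ 3 + 6 * t ^+ 4 + 2 * t ^+ 5)%:~R.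
Proof.
have size_p : (size (map_poly (in_alg L) (quintic_poly t)) <= 6)%N.
  by rewrite size_map_poly size_quintic.
rewrite (horner_coef_wide _ size_p) !big_ord_recr big_ord0 /= !coef_map quintic_polyE.
rewrite !coefE /= -!in_algE; ring.
Qed.

Lemma irreducible_no_root (p : {poly rat}) a :
  irreducible_poly p -> (2 < size p)%N -> ~~ root p a.
Proof.
move=> [_ irr_p] p_gt2; rewrite -dvdp_XsubCl; apply/negP => /irr_p.
by rewrite size_XsubC => /(_ isT)/eqp_size Dp; rewrite -Dp size_XsubC in p_gt2.
Qed.

Lemma minPoly_irreducible (p : {poly rat}) y :
    irreducible_poly p -> p \is monic -> root (map_poly (in_alg L) p) y ->
  minPoly 1 y = map_poly (in_alg L) p.
Proof.
move=> [_ irr_p] mon_p py0; have := minPoly_dvdp (alg_polyOver 1 p) py0.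
have /polyOver1P[q Dq] := minPolyOver 1 y.
have size_q : size q != 1%N.
  by rewrite -(size_map_poly (in_alg L)) -Dq size_minPoly.
rewrite Dq dvdp_map => /(irr_p q size_q).
rewrite eqp_monic //; first by move/eqP->.
by rewrite -(map_monic (in_alg L)) -Dq monic_minPoly.
Qed.

Lemma dim_Fadjoin_irreducible (p : {poly rat}) y :
    irreducible_poly p -> p \is monic -> root (map_poly (in_alg L) p) y ->
  \dim <<1; y>>%VS = (size p).-1.
Proof.
move=> irr_p mon_p py0; rewrite dim_Fadjoin dimv1 muln1.
apply: succn_inj; rewrite -size_minPoly (minPoly_irreducible irr_p) // size_map_poly.
by rewrite prednK // (ltn_trans _ irr_p.1).
Qed.

Lemma splittingField_galois (K E : {subfield L}) p :
    p \is a polyOver K -> splittingFieldFor K p E ->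
  galois K E.
Proof.
move=> Kp splitE; have sKE : (K <= E)%VS.
  by case: splitE => rs _ <-; apply: subv_adjoin_seq.
apply/and3P; split=> //; last by apply/(splitting_normalField sKE); exists p.
by have /and3P[_ sep _] := galois1 L; apply: separableS sep; rewrite ?sub1v ?subvf.
Qed.

End PolynomialRoots.

(** * The quartic field *)

Section QuarticGenerator.

Variable F : fieldType.
Implicit Types s y : F.

(** The quadratic formula: as a quadratic in Y^2, the quartic has discriminant 5(s^2 + 4)(s(s + 2)(s
    - 4))^2. The division by s - 4 is why t = 4 has to be set aside. *)
Definition quartic_sqrt s y : F :=
  (2 * y ^+ 2 + 5 * s * (s + 2) * (s ^+ 2 + 4)) / (s * (s + 2) * (s - 4)).

(** The roots come in pairs of opposites, and the product of one root from each pair is a square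
    root of the constant term, that is (s + 1)(s + 2) s w up to sign. *)
Definition quartic_conj s y : F := (s + 1) * (s + 2) * s * quartic_sqrt s y / y.

Variables s y : F.
Hypotheses (nz2 : 2 != 0 :> F) (nz5 : 5 != 0 :> F) (nz_s : s != 0) (nz_s1 : s + 1 != 0).
Hypotheses (nz_s2 : s + 2 != 0) (nz_s_4 : s - 4 != 0) (nz_ss4 : s ^+ 2 + 4 != 0).

Let quartic y := y ^+ 4 + 5 * (s + 2) * (s ^+ 2 + 4) * s * y ^+ 2
  + 5 * (s ^+ 2 + 4) * (s + 2) ^+ 2 * (s + 1) ^+ 2 * s ^+ 2.

Hypothesis qy0 : quartic y = 0.

Let w := quartic_sqrt s y.
Let y' := quartic_conj s y.

Let nz4 : 4 != 0 :> F.
Proof. by have := expf_neq0 2 nz2; rewrite -natrX. Qed.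

Lemma quartic_sqrt_sqr : w ^+ 2 = 5 * (s ^+ 2 + 4).
Proof.
apply/eqP; rewrite -subr_eq0; apply/eqP.
transitivity (quartic y * (4 / (s * (s + 2) * (s - 4)) ^+ 2)); last by rewrite qy0 mul0r.
by rewrite /w /quartic_sqrt /quartic; field; rewrite ?nz_s ?nz_s2 ?nz_s_4.
Qed.

Lemma quartic_sqr : y ^+ 2 = s * (s + 2) * w * (s - 4 - w) / 2.
Proof.
have -> : s * (s + 2) * w * (s - 4 - w) / 2 =
    s * (s + 2) / 2 * ((s - 4) * w - w ^+ 2) by field.
rewrite quartic_sqrt_sqr /w /quartic_sqrt.
by field; rewrite ?nz2 ?nz_s ?nz_s2 ?nz_s_4.
Qed.

Lemma quartic_neq0 : y != 0.
Proof.
apply: contra_eq_neq qy0 => ->; rewrite /quartic expr0n expr0n mulr0 !add0r /=.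
by rewrite !mulf_neq0 ?expf_neq0.
Qed.

Lemma quartic_sqrt_neq0 : w != 0.
Proof.
by apply: contra_eq_neq quartic_sqrt_sqr => ->; rewrite expr0n /= eq_sym mulf_neq0.
Qed.

Lemma quartic_conj_sqr : y' ^+ 2 = - (s * (s + 2) * w * (s - 4 + w) / 2).
Proof.
apply: (mulIf (expf_neq0 2 quartic_neq0)).
rewrite -exprMn /y' /quartic_conj divfK ?quartic_neq0 // -/w quartic_sqr.
(* Here w^2 - (s - 4)^2 = 4(s + 1)^2, which matches the factor s + 1 of [quartic_conj]. *)
have -> : - (s * (s + 2) * w * (s - 4 + w) / 2) * (s * (s + 2) * w * (s - 4 - w) / 2)
  = (s * (s + 2) * w) ^+ 2 * (w ^+ 2 - (s - 4) ^+ 2) / 4.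
  by field; rewrite ?nz2 ?nz4.
by rewrite quartic_sqrt_sqr; field.
Qed.

Lemma quartic_sqrt_conj : quartic_sqrt s y' = - w.
Proof.
rewrite {1}/quartic_sqrt quartic_conj_sqr.
have -> : 2 * - (s * (s + 2) * w * (s - 4 + w) / 2) + 5 * s * (s + 2) * (s ^+ 2 + 4)
  = s * (s + 2) * (5 * (s ^+ 2 + 4) - w ^+ 2 - w * (s - 4)) by field.
by rewrite quartic_sqrt_sqr; field; rewrite ?nz_s ?nz_s2 ?nz_s_4.
Qed.

Lemma quartic_conj_conj : quartic_conj s y' = - y.
Proof.
rewrite {1}/quartic_conj quartic_sqrt_conj /y' /quartic_conj -/w.
field; rewrite quartic_neq0 quartic_sqrt_neq0 ?nz_s ?nz_s1 ?nz_s2 //.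
Qed.

Lemma quartic_factor :
  'X^4 + (5 * (s + 2) * (s ^+ 2 + 4) * s) *: 'X^2
    + (5 * (s ^+ 2 + 4) * (s + 2) ^+ 2 * (s + 1) ^+ 2 * s ^+ 2)%:P
  = ('X - y%:P) * ('X - (- y)%:P) * ('X - y'%:P) * ('X - (- y')%:P).
Proof.
have Dy2 : y ^+ 2 + y' ^+ 2 = - (5 * (s + 2) * (s ^+ 2 + 4) * s).
  have -> : 5 * (s + 2) * (s ^+ 2 + 4) * s = s * (s + 2) * (5 * (s ^+ 2 + 4)) by ring.
  by rewrite quartic_conj_sqr quartic_sqr -quartic_sqrt_sqr; field.
have Dyy : y ^+ 2 * y' ^+ 2 = 5 * (s ^+ 2 + 4) * (s + 2) ^+ 2 * (s + 1) ^+ 2 * s ^+ 2.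
  rewrite -exprMn mulrC /y' /quartic_conj divfK ?quartic_neq0 // -/w exprMn quartic_sqrt_sqr.
  by ring.
have -> : 5 * (s + 2) * (s ^+ 2 + 4) * s = - (y ^+ 2 + y' ^+ 2) by rewrite Dy2 opprK.
by rewrite -Dyy -!mul_polyC; ring.
Qed.

End QuarticGenerator.

Lemma rmorph_quartic_conj (F G : fieldType) (f : {rmorphism F -> G}) s y :
  f (quartic_conj s y) = quartic_conj (f s) (f y).
Proof.
rewrite /quartic_conj /quartic_sqrt.
by rewrite !(rmorph1, rmorph_nat, rmorphXn, fmorphV, rmorphM, rmorphB, rmorphD).
Qed.

Section CyclicQuarticField.

Variables (L : splittingFieldType rat) (t : int).
Hypotheses (irr_q : irreducible_poly (quartic_poly t)) (t_neq4 : t != 4).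

(** Otherwise the constant term vanishes and the irreducible quartic has the root 0. *)
Lemma quartic_nondegenerate : [/\ t != 0, t + 1 != 0 & t + 2 != 0].
Proof.
suff [] : t * (t + 1) * (t + 2) != 0 by rewrite !mulf_eq0 !negb_or -andbA => /and3P.
have := irreducible_no_root 0 irr_q; rewrite size_quartic => /(_ isT).
apply: contra => /eqP t_bad; rewrite rootE horner_coef0 /quartic_poly !coefE /=.
have -> : 5 * (t%:~R ^+ 2 + 4) * (t%:~R + 2) ^+ 2 * (t%:~R + 1) ^+ 2 * t%:~R ^+ 2
  = 5 * (t%:~R ^+ 2 + 4) * (t * (t + 1) * (t + 2))%:~R ^+ 2 :> rat by ring.
by rewrite t_bad expr0n !mulr0 !addr0.
Qed.

Let s : L := t%:~R.

Lemma quartic_parameter_neq0 :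
  [/\ s != 0, s + 1 != 0, s + 2 != 0, s - 4 != 0 & [/\ s ^+ 2 + 4 != 0, 11 * s + 4 != 0,
    2 != 0 :> L & 5 != 0 :> L]].
Proof.
have [t0 t1 t2] := quartic_nondegenerate.
have nz (k : int) (x : L) : k != 0 -> k%:~R = x -> x != 0.
  by move=> nz_k <-; apply: intr_ext_neq0.
split; first exact: (nz t).
- by apply: (nz (t + 1)) => //; rewrite /s; ring.
- by apply: (nz (t + 2)) => //; rewrite /s; ring.
- by apply: (nz (t - 4)); [rewrite subr_eq0 | rewrite /s; ring].
split.
- by apply: (nz (t ^+ 2 + 4)); [nia | rewrite /s; ring].
- by apply: (nz (11 * t + 4)); [lia | rewrite /s; ring].
- exact: (nz 2).
- exact: (nz 5).
Qed.

Variable y : L.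
Hypothesis qy0 : root (map_poly (in_alg L) (quartic_poly t)) y.

Lemma quartic_eq :
  y ^+ 4 + 5 * (s + 2) * (s ^+ 2 + 4) * s * y ^+ 2
  + 5 * (s ^+ 2 + 4) * (s + 2) ^+ 2 * (s + 1) ^+ 2 * s ^+ 2 = 0.
Proof. by rewrite -[RHS](rootP qy0) horner_quartic. Qed.

Let w := quartic_sqrt s y.
Let y' := quartic_conj s y.

Lemma quartic_sqrt_in : w \in <<1; y>>%VS.
Proof.
have := memv_adjoin 1 y => Ky.
by rewrite /w /quartic_sqrt rpred_div ?(rpred_nat, rpred_int, rpredX, rpredM, rpredB, rpredD).
Qed.

Lemma quartic_conj_in : y' \in <<1; y>>%VS.
Proof.
have := memv_adjoin 1 y => Ky; have := quartic_sqrt_in.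
rewrite /y' /quartic_conj -/w; move: w => w' Kw'.
by rewrite rpred_div ?(rpred1, rpred_nat, rpred_int, rpredM, rpredD).
Qed.

Lemma dim_quartic_field : \dim <<1; y>>%VS = 4%N.
Proof. by rewrite (dim_Fadjoin_irreducible irr_q (monic_quartic t) qy0) size_quartic. Qed.

Lemma quartic_field_cyclic : cyclic_extension 1%AS <<1; y>>%AS.
Proof.
have [nz_s nz_s1 nz_s2 nz_s_4 [nz_ss4 _ nz2 nz5]] := quartic_parameter_neq0.
have Dq : map_poly (in_alg L) (quartic_poly t)
    = ('X - y%:P) * ('X - (- y)%:P) * ('X - y'%:P) * ('X - (- y')%:P).
  rewrite -quartic_factor ?quartic_eq //.
  rewrite /quartic_poly !rmorphD /= map_polyXn linearZ /= map_polyXn map_polyC.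
  by congr (_ + _ *: _ + _%:P); rewrite /= -!in_algE /s; ring.
have galK : galois 1%AS <<1; y>>%AS.
  apply: (@splittingField_galois L 1%AS <<1; y>>%AS (map_poly (in_alg L) (quartic_poly t))).
    exact: alg_polyOver.
  exists [:: y; - y; y'; - y'].
    by rewrite Dq !big_cons big_nil mulr1 !mulrA eqpxx.
  apply/eqP; rewrite eqEsubv; apply/andP; split.
    apply/Fadjoin_seqP; split; first exact: subv_adjoin.
    have Ky := memv_adjoin 1 y; have Ky' := quartic_conj_in.
    by move=> z; rewrite !inE => /or4P[] /eqP->; rewrite ?rpredN.
  by apply/FadjoinP; split; [apply: subv_adjoin_seq | apply: seqv_sub_adjoin; rewrite mem_head].
split=> //; have sK := sub1v <<1; y>>%AS.
have [g Gg gy] : exists2 g : gal_of <<1; y>>%AS, g \in 'Gal(<<1; y>>%AS / 1%AS)%g & g y = y'.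
  apply: normalField_root_minPoly => //; [by case/and3P: galK | exact: memv_adjoin |].
  rewrite (minPoly_irreducible irr_q (monic_quartic t) qy0).
  by rewrite rootE Dq !hornerE subrr !(mulr0, mul0r).
have card_G : #|'Gal(<<1; y>>%AS / 1%AS)%g| = 4%N.
  by rewrite -(galois_dim galK) /= dim_quartic_field dimv1 divn1.
have gs : g s = s by rewrite /s rmorph_int.
have gyy : (g ^+ 2)%g y = - y.
  rewrite expgS expg1 galM ?memv_adjoin // gy.
  (* [quartic_conj] is a rational expression over the rationals, so [g] commutes with it. *)
  transitivity (quartic_conj s y'); last by apply: quartic_conj_conj; rewrite ?quartic_eq.
  have E : g (quartic_conj s y) = quartic_conj (g s) (g y) := rmorph_quartic_conj g s y.
  by rewrite [LHS]E gs gy.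
apply/cyclicP; exists g; apply/eqP; rewrite eq_sym eqEcard cycle_subG Gg card_G -orderE /=.
have : (#[g]%g %| 4)%N by rewrite -card_G order_dvdG.
have : ~~ (#[g]%g %| 2)%N.
  rewrite order_dvdn; apply/eqP => g2; move: gyy; rewrite g2 gal_id => /eqP.
  rewrite -subr_eq0 opprK -mulr2n -mulr_natl mulf_eq0 (negPf nz2) /=.
  by rewrite (negPf (quartic_neq0 nz5 nz_s nz_s1 nz_s2 nz_ss4 quartic_eq)).
by case: #[g]%g => [|[|[|[|]]]].
Qed.

End CyclicQuarticField.

(** * The quintic extension *)

Section QuinticExtension.

Variables (L : splittingFieldType rat) (t : int) (y : L).
Hypotheses (irr_q : irreducible_poly (quartic_poly t)) (t_neq4 : t != 4).
Hypothesis qy0 : root (map_poly (in_alg L) (quartic_poly t)) y.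
Hypothesis irr_p : irreducible_poly (quintic_poly t).

Let s : L := t%:~R.
Let p := map_poly (in_alg L) (quintic_poly t).
Let K := <<1; y>>%AS.

Lemma horner_quintic_shift x : p.[x] = shifted_quintic s (x - 1).
Proof. by rewrite horner_quintic /shifted_quintic /s; ring. Qed.

(* The discriminant of the quadratic factor is the square of an element of
   K(x), so that the factor splits there. *)
Lemma quadratic_factor_root (M : {subfield L}) x r w v :
    x \in M -> w \in M -> v \in M -> shifted_quintic s x = 0 ->
    w ^+ 2 = 5 * (s ^+ 2 + 4) -> v ^+ 2 = s * (s + 2) * w * (s - 4 - w) / 2 ->
    r ^+ 2 + (x + 5) / 2 * r + fac_b s x - w * (fac_a s x * r - fac_c s x) = 0 ->
  r \in M.
Proof.
have [nz_s nz_s1 nz_s2 nz_s_4 [nz_ss4 nz_s11 nz2 nz5]] := @quartic_parameter_neq0 L t irr_q t_neq4.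
move=> Mx Mw Mv px0 Dw Dv r0.
have Ms : s \in M by rewrite rpred_int.
have disc := quadratic_factor_disc nz2 nz_s nz_s1 nz_s2 nz_ss4 nz_s11 Dw Dv px0.
have Mfac : [/\ fac_a s x \in M, fac_d s x \in M & fac_e s x \in M].
  by rewrite /fac_a /fac_d /fac_e; split; rewrite rpred_div
    ?(rpred1, rpred_nat, rpredX, rpredM, rpredB, rpredN, rpredD).
move: (fac_a s x) (fac_b s x) (fac_c s x) (fac_d s x) (fac_e s x) Mfac disc r0.
move=> a b c d e [Ma Md Me] disc r0.
set A := - (x + 5) / 2 + w * a in disc.
set C := v * _ in disc.
have MA : A \in M by rewrite /A rpredD ?rpred_div ?(rpred_nat, rpredN, rpredM, rpredD).
have MC : C \in M by rewrite /C rpredM ?rpredD ?rpredM.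
have : (2 * r - A) ^+ 2 = C ^+ 2.
  rewrite -disc; apply/eqP; rewrite -subr_eq0; apply/eqP.
  transitivity (4 * (r ^+ 2 + (x + 5) / 2 * r + b - w * (a * r - c)));
    last by rewrite r0 mulr0.
  by rewrite /A; field.
clearbody A C; move=> /eqP; rewrite eqf_sqr => /orP[] /eqP Dr.
  have -> : r = (A + C) / 2 by rewrite -Dr; field.
  by rewrite rpred_div ?(rpred_nat, rpredD).
have -> : r = (A - C) / 2 by rewrite -[C]opprK -Dr; field.
by rewrite rpred_div ?(rpred_nat, rpredB).
Qed.

Lemma quintic_root_adjoin x r : root p x -> root p r -> r \in <<K; x>>%VS.
Proof.
have [nz_s nz_s1 nz_s2 nz_s_4 [nz_ss4 nz_s11 nz2 nz5]] := @quartic_parameter_neq0 L t irr_q t_neq4.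
have qy := quartic_eq qy0.
move=> /rootP; rewrite horner_quintic_shift => px0 /rootP; rewrite horner_quintic_shift.
pose M := <<K; x>>%AS.
have Mx : x \in M by apply: memv_adjoin.
have sKM : {subset K <= M} by apply/subvP/subv_adjoin.
have Mv : y \in M by apply/sKM/memv_adjoin.
have Mw : quartic_sqrt s y \in M by apply/sKM/quartic_sqrt_in.
have Mv' : quartic_conj s y \in M by apply/sKM/quartic_conj_in.
have Dw : quartic_sqrt s y ^+ 2 = 5 * (s ^+ 2 + 4) by apply: quartic_sqrt_sqr.
have Mx1 : x - 1 \in M by rewrite rpredB ?rpred1.
rewrite (shifted_quintic_factor (r - 1) nz2 nz_s nz_s2 nz_ss4 nz_s11 Dw px0).
suff: (r - 1 - (x - 1) = 0) \/ r - 1 \in M -> r \in M.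
  move=> Mr /eqP; rewrite !mulf_eq0 -orbA => /or3P[] /eqP r0; apply: Mr; [by left | right | right].
    apply: (quadratic_factor_root Mx1 Mw Mv px0 Dw _ r0).
    exact: quartic_sqr.
  (* The second factor is the first one with w replaced by -w, whose companion is the conjugate of
     y, again in K. *)
  apply: (@quadratic_factor_root M (x - 1) (r - 1) (- quartic_sqrt s y) (quartic_conj s y)) => //.
  - by rewrite rpredN.
  - by rewrite sqrrN.
  - by rewrite quartic_conj_sqr //; field.
  - by rewrite -[RHS]r0; ring.
case=> [/eqP | Mr1]; last by rewrite -(subrK 1 r) rpredD ?rpred1.
by rewrite subr_eq0 => /eqP/addIr->.
Qed.

Variable E : {subfield L}.
Hypothesis splitE : splittingFieldFor K p E.

Lemma quintic_splitting_adjoin x : root p x -> <<K; x>>%VS = E.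
Proof.
case: splitE => rs Dp defE px0; apply/eqP; rewrite eqEsubv; apply/andP; split.
  apply/FadjoinP; rewrite -defE; split; first exact: subv_adjoin_seq.
  by apply: seqv_sub_adjoin; rewrite -root_prod_XsubC -(eqp_root Dp).
rewrite -defE; apply/(@Fadjoin_seqP _ _ K rs <<K; x>>%AS); split=> [|r rs_r].
  exact: subv_adjoin.
by apply: quintic_root_adjoin => //; rewrite (eqp_root Dp) root_prod_XsubC.
Qed.

Lemma quintic_root_exists : exists2 x, root p x & x \in E.
Proof.
case: splitE => [[|x rs] Dp defE].
  have := eqp_size Dp; rewrite big_nil size_poly1 size_map_poly size_quintic //.
exists x; first by rewrite (eqp_root Dp) root_prod_XsubC mem_head.
by rewrite -defE; apply: seqv_sub_adjoin; rewrite mem_head.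
Qed.

Lemma quintic_galois : galois K E.
Proof. by apply: splittingField_galois splitE; apply: alg_polyOver. Qed.

(** A root x has degree 5 over the rationals; K has degree 4, prime to 5, so the degree of x over K
    is still 5. *)
Lemma card_quintic_Gal : #|'Gal(E / K)%g| = 5%N.
Proof.
have [x px0 Ex] := quintic_root_exists.
have defE := quintic_splitting_adjoin px0.
rewrite -(galois_dim quintic_galois) -defE -adjoin_degreeE.
have deg_le : (adjoin_degree K x <= 5)%N.
  rewrite -ltnS -size_minPoly -(size_quintic t) -(size_map_poly (in_alg L)).
  apply: dvdp_leq; first by rewrite map_poly_eq0 monic_neq0 ?monic_quintic.
  by apply: minPoly_dvdp => //; apply: alg_polyOver.
have dim_x := dim_Fadjoin_irreducible irr_p (monic_quintic t) px0.
have : (\dim <<1; x>> %| \dim <<K; x>>)%N.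
  by rewrite defE; apply: field_dimS; rewrite sub_adjoin1v.
rewrite dim_x size_quintic dim_Fadjoin (dim_quartic_field irr_q qy0).
by rewrite Gauss_dvdl // => /dvdn_leq deg_ge; apply/eqP; rewrite eqn_leq deg_le deg_ge.
Qed.

Lemma quintic_field_cyclic : cyclic_extension K E.
Proof.
by split; [apply: quintic_galois | apply: prime_cyclic; rewrite card_quintic_Gal].
Qed.

Lemma quintic_no_int_root (k : int) :
  k ^+ 5 - 10 * k ^+ 3 + 5 * (4 + 4 * t + 2 * t ^+ 2 + t ^+ 3) * k ^+ 2
    - 5 * (3 + 8 * t + 4 * t ^+ 2 + 2 * t ^+ 3 + t ^+ 4) * k
    + (4 + 20 * t + 26 * t ^+ 2 + 13 * t ^+ 3 + 6 * t ^+ 4 + 2 * t ^+ 5) != 0.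
Proof.
have := irreducible_no_root k%:~R irr_p; rewrite size_quintic => /(_ isT).
apply: contra => /eqP k0; rewrite -(fmorph_root (in_alg L)) rmorph_int rootE horner_quintic.
apply/eqP; rewrite -[RHS](_ : 0%:~R = 0) // -[in RHS]k0; ring.
Qed.

Hypothesis adm_t : admissible t.

Lemma quintic_unramified_at_primes : unramified_at_primes K E.
Proof.
move=> P Q prP prQ PQ; have galE := quintic_galois; have card_G := card_quintic_Gal.
apply: (trivial_inertia_unramified prQ galE PQ) => g Gg nt_g.
apply: NNPP => no_z.
have inert_g z : ring_of_integers E z -> Q (g z - z).
  by move=> Oz; apply: NNPP => Qz; apply: no_z; exists z.
have defG : 'Gal(E / K)%g = <[g]>%g.
  apply/eqP; rewrite eq_sym eqEcard cycle_subG Gg -orderE card_G /=.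
  have : (#[g]%g %| 5)%N by rewrite -card_G order_dvdG.
  rewrite dvdn_divisors // !inE => /orP[]; last by move/eqP->.
  by rewrite order_eq1 (negPf nt_g).
have inert (h : gal_of E) z : h \in 'Gal(E / K)%g -> ring_of_integers E z -> Q (h z - z).
  rewrite defG => /cycleP[i ->] Oz; elim: i => [|i IH].
    by rewrite expg0 gal_id subrr; apply: prime0 prQ.
  rewrite expgSr galM; last by case: Oz.
  have -> : g ((g ^+ i)%g z) - z = (g ((g ^+ i)%g z) - (g ^+ i)%g z) + ((g ^+ i)%g z - z).
    by rewrite addrA subrK.
  by apply: (prime_add prQ) => //; apply/inert_g/OO_gal.
have [x px0 Ex] := quintic_root_exists.
have defEx := quintic_splitting_adjoin px0.
have px : p.[x] = 0 by apply/rootP.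
rewrite horner_quintic in px.
have [z [c0 [c1 [c2 [c3 [c4 [xz zx pz0 c4_5]]]]]]] :=
  exists_five_adic_generator adm_t quintic_no_int_root px.
apply: (no_total_inertia prQ galE card_G inert defEx _ px pz0 c4_5).
apply/eqP; rewrite eqEsubv; have sKE : (K <= E)%VS by case/and3P: galE.
apply/andP; split; first apply/FadjoinP; last rewrite -defEx; last apply/FadjoinP.
  split=> //; apply: subvP xz; apply/(@FadjoinP _ _ 1%AS x E); split=> //; exact: sub1v.
split; first exact: subv_adjoin.
by apply: subvP zx; apply: (adjoinSl z (sub1v K)).
Qed.

Lemma quartic_field_imaginary (f : {rmorphism L -> algC}) :
  exists2 z, z \in K & f z \isn't Num.real.
Proof.
exists y; first exact: memv_adjoin.
have [t0 t1 t2] := quartic_nondegenerate irr_q.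
apply/negP => real_fy; have := congr1 f (quartic_eq qy0); rewrite rmorph0.
pose b : int := 5 * (t + 2) * (t ^+ 2 + 4) * t.
pose c : int := 5 * (t ^+ 2 + 4) * ((t + 2) * (t + 1) * t) ^+ 2.
(* Among integers, t(t + 2) is negative only at the excluded value -1. With [b] nonnegative and [c]
   positive the quartic has no real root. *)
have b_ge0 : 0 <= b by rewrite /b; nia.
have c_gt0 : 0 < c.
  by rewrite /c mulr_gt0 ?exprn_even_gt0 ?mulf_neq0 //; nia.
have -> : y ^+ 4 + 5 * (s + 2) * (s ^+ 2 + 4) * s * y ^+ 2
    + 5 * (s ^+ 2 + 4) * (s + 2) ^+ 2 * (s + 1) ^+ 2 * s ^+ 2
  = y ^+ 4 + b%:~R * y ^+ 2 + c%:~R by rewrite /b /c /s; ring.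
clearbody b c; rewrite !(rmorph_int, rmorphXn, rmorphM, rmorphD) /= => /eqP; apply/negP.
rewrite gt_eqF // ltr_wpDl ?ltr0z //.
apply: addr_ge0; first exact: real_exprn_even_ge0.
by apply: mulr_ge0; [rewrite ler0z | apply: real_exprn_even_ge0].
Qed.

Lemma quintic_unramified : unramified K E.
Proof.
split; first by case/and3P: quintic_galois.
  exact: quintic_unramified_at_primes.
by move=> f real_K; have [z /real_K Rz /negP[]] := quartic_field_imaginary f.
Qed.

End QuinticExtension.

Lemma admissible_neq4 t : admissible t -> t != 4.
Proof.
by move=> adm_t; apply/eqP => t4; case: adm_t => [[]|[]|] /eqP; rewrite t4 eqz_mod_dvd; lia.
Qed.

Theorem theorem8 (t : int) (ht : admissible t)
    (hq : irreducible_poly (quartic_poly t))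
    (L : splittingFieldType rat) (y : L)
    (hy : root (map_poly (in_alg L) (quartic_poly t)) y) :
  cyclic_extension 1%AS <<1; y>>%AS /\
  (irreducible_poly (quintic_poly t) ->
   forall E : {subfield L},
     splittingFieldFor <<1; y>>%VS
       (map_poly (in_alg L) (quintic_poly t)) E ->
     unramified <<1; y>>%AS E /\ cyclic_extension <<1; y>>%AS E).
Proof.
have t_neq4 := admissible_neq4 ht.
split=> [|irr_p E splitE]; first exact: (quartic_field_cyclic hq t_neq4 hy).
by split; [exact: (quintic_unramified hq t_neq4 hy irr_p splitE ht) |
  exact: (quintic_field_cyclic hq t_neq4 hy irr_p splitE)].
Qed.
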